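(* Let $\mathcal X$ be a complex Banach space, let $A,B,C\in B(\mathcal X)$, and let $M_C=\begin{pmatrix} A & C\\ 0 & B\end{pmatrix}$, acting on $\mathcal X\oplus\mathcal X$. If either $P=A$ and $Q=B$, or $P=A^*$ and $Q=B^*$, then $$\sigma_w(A)\cup\sigma_w(B)\subseteq\sigma_w(M_C)\cup\{\Xi(P)\cup\Xi(Q)\}.$$
   Context: $B(\mathcal Y)$ is the algebra of bounded linear operators on a complex Banach space $\mathcal Y$; $T^*$ is the adjoint of $T$ acting on the dual space. For $T\in B(\mathcal Y)$: $\alpha(T)=\dim T^{-1}(0)$, $\beta(T)=\dim(\mathcal Y/T\mathcal Y)$; $T$ is Fredholm at $\lambda\in\mathbb C$ if $(T-\lambda)\mathcal Y$ is closed, $\alpha(T-\lambda)<\infty$ and $\beta(T-\lambda)<\infty$, and then $\mathrm{ind}(T-\lambda)=\alpha(T-\lambda)-\beta(T-\lambda)$. $T$ is Weyl at $\lambda$ if it is Fredholm at $\lambda$ with $\mathrm{ind}(T-\lambda)=0$; the Weyl spectrum is $\sigma_w(T)=\{\lambda\in\mathbb C: T\text{ is not Weyl at }\lambda\}$. $T$ has SVEP (the single-valued extension property) at $\lambda_0\in\mathbb C$ if for every open disc $\mathcal D$ centered at $\lambda_0$ the only analytic function $f:\mathcal D\to\mathcal Y$ with $(T-\lambda)f(\lambda)=0$ for all $\lambda\in\mathcal D$ is $f\equiv 0$. $\Xi(T)$ denotes the set of $\lambda\in\mathbb C$ at which $T$ does not have SVEP. *)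

(* Defs.v *)
From HB Require Import structures.
From mathcomp Require Import all_boot all_order all_algebra.
From mathcomp Require Import complex.
From mathcomp Require Import all_classical all_reals all_analysis.

Set Implicit Arguments.
Unset Strict Implicit.
Unset Printing Implicit Defensive.

Import Order.TTheory GRing.Theory Num.Theory.
Import numFieldNormedType.Exports.

Local Open Scope classical_set_scope.
Local Open Scope complex_scope.
Local Open Scope ring_scope.

Section BoundedOperators.
Context {R : realType}.
Implicit Types X Y : normedModType R[i].

Definition bounded_linear X Y : {pred X -> Y} :=
  [pred f | `[< linear f /\ exists M, forall x, `|f x| <= M * `|x| >]].

Record bounded_op X Y := BoundedOp {
  bop_fun :> X -> Y;
  bop_bounded : bop_fun \in @bounded_linear X Y }.

HB.instance Definition _ X Y := [isSub for @bop_fun X Y].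
HB.instance Definition _ X Y := [Choice of bounded_op X Y by <:].

Section Theory.
Context {X Y : normedModType R[i]}.
Implicit Types f g : bounded_op X Y.

Lemma bounded_linearP (f : X -> Y) :
  reflect (linear f /\ exists M, forall x, `|f x| <= M * `|x|)
          (f \in @bounded_linear X Y).
Proof. exact: asboolP. Qed.

Lemma bounded_op_linear f : linear f.
Proof. by have /bounded_linearP[] := bop_bounded f. Qed.

HB.instance Definition _ f :=
  GRing.isLinear.Build R[i] X Y *:%R f (@bounded_op_linear f).

Lemma linearZZ f (a : R[i]) x : f (a *: x) = a *: f x.
Proof. exact: linearZ. Qed.

Lemma bounded_linear_submod : submod_closed (@bounded_linear X Y).
Proof.
split.
  apply/bounded_linearP; split; first by move=> a x y /=; rewrite scaler0 addr0.
  by exists 0 => x; rewrite /= normr0 mul0r.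
move=> a f g /bounded_linearP[lf [M Mf]] /bounded_linearP[lg [N Ng]].
apply/bounded_linearP; split => [b x y|].
  rewrite !fctE lf lg !scalerDr !scalerA (mulrC a b).
  by rewrite addrACA.
exists (`|a| * M + N) => x; rewrite !fctE (le_trans (ler_normD _ _))// mulrDl.
by rewrite lerD// normrZ -mulrA ler_wpM2l.
Qed.

HB.instance Definition _ :=
  GRing.isSubmodClosed.Build R[i] (X -> Y) (@bounded_linear X Y)
    bounded_linear_submod.
HB.instance Definition _ :=
  [SubChoice_isSubLmodule of bounded_op X Y by <:].

Lemma bounded_opP f g : (forall x, f x = g x) -> f = g.
Proof. by move=> fg; apply/val_inj/funext. Qed.

Lemma bounded_opDE f g x : (f + g) x = f x + g x. Proof. by []. Qed.
Lemma bounded_opBE f g x : (f - g) x = f x - g x. Proof. by []. Qed.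
Lemma bounded_opZE a f x : (a *: f) x = a *: f x. Proof. by []. Qed.

(* The norm of a normed module over R[i] is R[i]-valued, with real values;
   [Re] brings it to R, where suprema exist. *)
Definition opnorm f : R :=
  sup [set complex.Re `|f x| | x in [set x | `|x| <= 1]].

Lemma normC_Re (V : normedZmodType R[i]) (v : V) :
  (complex.Re `|v|)%:C = `|v|.
Proof. by rewrite RRe_real// ger0_real. Qed.

Let realCM (a b : R) : (a * b)%:C = a%:C * b%:C.
Proof. exact: rmorphM. Qed.

Let realCV (a : R) : (a^-1)%:C = (a%:C)^-1.
Proof. exact: fmorphV. Qed.

Lemma bounded_op_bound f :
  exists2 M : R, 0 <= M & forall x, `|f x| <= M%:C * `|x|.
Proof.
have /bounded_linearP[_ [M Mf]] := bop_bounded f.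
exists (complex.Re `|M|); first by rewrite -ler0c normC_Re.
move=> x; rewrite normC_Re.
have <- : `|M * `|x| | = `|M| * `|x| by rewrite normrM normr_id.
by rewrite ger0_norm// (le_trans _ (Mf x)).
Qed.

Lemma opnorm_ub f (x : X) : `|x| <= 1 -> complex.Re `|f x| <= opnorm f.
Proof.
move=> x1; apply: ub_le_sup; last by exists x.
have [M M0 Mf] := bounded_op_bound f; exists M => _ [y /= y1 <-].
rewrite -lecR normC_Re (le_trans (Mf y))// -[leRHS]mulr1 ler_wpM2l//.
by rewrite ler0c.
Qed.

Lemma opnorm_ge0 f : 0 <= opnorm f.
Proof.
apply: le_trans (@opnorm_ub f 0 _); last by rewrite normr0.
by rewrite -ler0c normC_Re.
Qed.

Lemma opnorm_le f (M : R) : 0 <= M ->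
  (forall x, `|f x| <= M%:C * `|x|) -> opnorm f <= M.
Proof.
move=> M0 fM; apply: ge_sup.
  by exists (complex.Re `|f 0|), 0 => //=; rewrite normr0.
move=> _ [x /= x1 <-]; rewrite -lecR normC_Re (le_trans (fM x))//.
by rewrite -[leRHS]mulr1 ler_wpM2l// ler0c.
Qed.

Lemma ler_opnorm f x : `|f x| <= (opnorm f)%:C * `|x|.
Proof.
have [->|x0] := eqVneq x 0.
  by rewrite (raddf0 f) !normr0 mulr0.
rewrite -ler_pdivrMr ?normr_gt0// mulrC.
have -> : `|x|^-1 * `|f x| = `|f (`|x|^-1 *: x)|.
  by rewrite (linearZZ f) normrZ normfV normr_id.
rewrite -normC_Re lecR opnorm_ub// normrZ normfV normr_id mulVf//.
by rewrite normr_eq0.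
Qed.

Lemma opnormD f g : (opnorm (f + g))%:C <= (opnorm f)%:C + (opnorm g)%:C.
Proof.
rewrite -rmorphD/= lecR; apply: opnorm_le => [|x].
  by rewrite addr_ge0// opnorm_ge0.
by rewrite rmorphD/= mulrDl (le_trans (ler_normD _ _))// lerD// ler_opnorm.
Qed.

Lemma opnormZ_le (a : R[i]) f : opnorm (a *: f) <= complex.Re `|a| * opnorm f.
Proof.
apply: opnorm_le => [|x].
  by rewrite mulr_ge0// ?opnorm_ge0// -ler0c normC_Re.
rewrite realCM normC_Re bounded_opZE normrZ -mulrA ler_wpM2l//.
exact: ler_opnorm.
Qed.

Lemma opnormZ (a : R[i]) f : (opnorm (a *: f))%:C = `|a| * (opnorm f)%:C.
Proof.
rewrite -(normC_Re a) -realCM; congr (_%:C).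
apply/eqP; rewrite eq_le opnormZ_le andTb.
have [->|a0] := eqVneq a 0.
  have -> : complex.Re `|0 : R[i]| = 0 by rewrite normr0.
  by rewrite mul0r opnorm_ge0.
have Ra : 0 < complex.Re `|a| by rewrite -ltcR normC_Re normr_gt0.
rewrite -ler_pdivlMl// -[in leLHS](scalerK a0 f) (le_trans (opnormZ_le _ _))//.
rewrite ler_wpM2r ?opnorm_ge0//.
have -> : complex.Re `|a^-1| = (complex.Re `|a|)^-1.
  by apply: complexI; rewrite normC_Re normfV realCV normC_Re.
by [].
Qed.

Lemma opnorm0_eq0 f : (opnorm f)%:C = 0 -> f = 0.
Proof.
move=> f0; apply: bounded_opP => x; apply/eqP.
by rewrite -normr_le0 (le_trans (ler_opnorm f x))// f0 mul0r.
Qed.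

HB.instance Definition _ := Lmodule_isNormed.Build R[i] (bounded_op X Y)
  opnormD opnormZ opnorm0_eq0.

End Theory.

Lemma id_bounded X : id \in @bounded_linear X X.
Proof. by apply/bounded_linearP; split=> //; exists 1 => x; rewrite mul1r. Qed.

Definition id_op X := BoundedOp (id_bounded X).

Definition dual X := bounded_op X R[i]^o.

Section Adjoint.
Context {X Y : normedModType R[i]} (T : bounded_op X Y).

Lemma dual_comp_bounded (g : dual Y) : g \o T \in @bounded_linear X R[i]^o.
Proof.
apply/bounded_linearP; split=> [a x y /=|]; first by rewrite !linearP.
exists ((opnorm g)%:C * (opnorm T)%:C) => x /=.
rewrite (le_trans (ler_opnorm _ _))// -mulrA ler_wpM2l ?ler0c ?opnorm_ge0//.
exact: ler_opnorm.
Qed.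

Definition adjoint_fun (g : dual Y) : dual X := BoundedOp (dual_comp_bounded g).

Lemma adjoint_bounded : adjoint_fun \in @bounded_linear (dual Y) (dual X).
Proof.
apply/bounded_linearP; split=> [a g h|]; first exact: bounded_opP.
exists (opnorm T)%:C => g; rewrite mulrC -rmorphM/= lecR.
apply: opnorm_le => [|x]; first by rewrite mulr_ge0// opnorm_ge0.
rewrite rmorphM/= (le_trans (ler_opnorm _ _))// -mulrA ler_wpM2l//.
  by rewrite ler0c opnorm_ge0.
exact: ler_opnorm.
Qed.

(* Banach-space adjoint, g |-> g \o T, with no complex conjugation. *)
Definition adjoint : bounded_op (dual Y) (dual X) := BoundedOp adjoint_bounded.

End Adjoint.

Section BlockTriangular.
Context {X Y : normedModType R[i]}.
Variables (A : bounded_op X X) (C : bounded_op Y X) (B : bounded_op Y Y).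

Lemma block_triangular_bounded :
  (fun z : X * Y => (A z.1 + C z.2, B z.2)) \in
    @bounded_linear (X * Y)%type (X * Y)%type.
Proof.
apply/bounded_linearP; split=> [a x y /=|].
  congr pair; last exact: bounded_op_linear.
  by rewrite !bounded_op_linear addrACA -scalerDr.
pose M := ((opnorm A)%:C + (opnorm C)%:C + (opnorm B)%:C : R[i]).
have A0 : 0 <= (opnorm A)%:C :> R[i] by rewrite ler0c opnorm_ge0.
have B0 : 0 <= (opnorm B)%:C :> R[i] by rewrite ler0c opnorm_ge0.
have C0 : 0 <= (opnorm C)%:C :> R[i] by rewrite ler0c opnorm_ge0.
exists M => z /=.
have z1 : `|z.1| <= `|z|.
  by rewrite [leRHS]prod_normE comparable_le_max ?lexx// real_comparable.
have z2 : `|z.2| <= `|z|.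
  rewrite [leRHS]prod_normE comparable_le_max ?lexx ?orbT//.
  by rewrite real_comparable.
have Az : `|A z.1| <= (opnorm A)%:C * `|z|.
  by rewrite (le_trans (ler_opnorm _ _))// ler_wpM2l.
have Bz : `|B z.2| <= (opnorm B)%:C * `|z|.
  by rewrite (le_trans (ler_opnorm _ _))// ler_wpM2l.
have Cz : `|C z.2| <= (opnorm C)%:C * `|z|.
  by rewrite (le_trans (ler_opnorm _ _))// ler_wpM2l.
rewrite [leLHS]prod_normE/= comparable_ge_max ?real_comparable//.
rewrite /M 2!mulrDl; apply/andP; split.
  rewrite (le_trans (ler_normD _ _))// (le_trans (lerD Az Cz))//.
  by rewrite lerDl mulr_ge0.
by rewrite (le_trans Bz)// lerDr addr_ge0// mulr_ge0.
Qed.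

(* The operator matrix [A C; 0 B] on X (+) Y. *)
Definition block_triangular : bounded_op (X * Y)%type (X * Y)%type :=
  BoundedOp block_triangular_bounded.

End BlockTriangular.

Section Dimension.
Context {V : lmodType R[i]}.
Implicit Types U W : set V.

(* dim (U / W) = n, for subspaces W `<=` U: the classes mod W of some vectors
   e_0, ..., e_(n-1) of U form a basis of U / W. *)
Definition quotient_dim U W (n : nat) :=
  exists e : 'I_n -> V,
    [/\ forall i, U (e i),
        forall c : 'I_n -> R[i], W (\sum_(i < n) c i *: e i) ->
          forall i, c i = 0
      & forall u, U u -> exists c : 'I_n -> R[i],
          W (u - \sum_(i < n) c i *: e i)].

Definition finite_quotient U W := exists n, quotient_dim U W n.

(* The default value 0 also stands for an infinite dimension, so this is only
   meaningful under [finite_quotient U W]. *)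
Definition dim_quotient U W : nat := xget 0%N (quotient_dim U W).

End Dimension.

Section Spectra.
Context {Y : normedModType R[i]}.
Implicit Types T : bounded_op Y Y.

Definition shift_op T (lambda : R[i]) : bounded_op Y Y :=
  T - lambda *: id_op Y.

Definition ker_op T : set Y := [set y | T y = 0].

Definition finite_alpha T := finite_quotient (ker_op T) [set 0].
Definition finite_beta T := finite_quotient setT (range T).
Definition alpha T : nat := dim_quotient (ker_op T) [set 0].
Definition beta T : nat := dim_quotient setT (range T).

Definition fredholm_at T lambda :=
  [/\ closed (range (shift_op T lambda)),
      finite_alpha (shift_op T lambda) & finite_beta (shift_op T lambda)].

Definition ind T : int := (alpha T)%:Z - (beta T)%:Z.

Definition weyl_at T lambda :=
  fredholm_at T lambda /\ ind (shift_op T lambda) = 0.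

Definition weyl_spectrum T : set R[i] := [set lambda | ~ weyl_at T lambda].

(* Analytic on the open set D: complex differentiable, for the norm of Y,
   at every point of D. *)
Definition analytic_on (D : set R[i]^o) (f : R[i]^o -> Y) :=
  forall z, D z -> derivable f z 1.

Definition svep_at T (lambda0 : R[i]) :=
  forall r : R[i], 0 < r -> forall f : R[i]^o -> Y,
    analytic_on (ball (lambda0 : R[i]^o) r) f ->
    (forall z, ball (lambda0 : R[i]^o) r z -> shift_op T z (f z) = 0) ->
    forall z, ball (lambda0 : R[i]^o) r z -> f z = 0.

Definition no_svep T : set R[i] := [set lambda | ~ svep_at T lambda].

End Spectra.
End BoundedOperators.

(* Main.v *)
(** Write [M] for the block matrix and shift everything by [l]. If [M] is
    Fredholm, then [ker A] and [X / range B] are finite dimensional, and the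
    snake sequence
      [0 -> ker A -> ker M -> ker B
         -> X/range A -> (X+X)/range M -> X/range B -> 0]
    gives [ind M = ind A + ind B] as soon as [ker B] or [X / range A] is finite
    dimensional too. So it suffices to see that SVEP forces the index to have a
    sign: if [S = T - l] has a range of codimension [n] and [dim ker S > n],
    then iterating a bounded section of [S] (open mapping theorem) from [n + 1]
    independent kernel vectors gives power series [x_j(z)] such that
    [(S - z) x_j(z)] stays in an n-dimensional complement of the range; an
    analytic combination of the [x_j] therefore is a nonzero local solution of
    [(S - z) f(z) = 0].

    For the adjoints, the same result in the dual bounds [dim ker S*] by
    [dim X*/range S*]; these numbers are compared with [dim X/range S] and
    [dim ker S] using that [M] has closed range of finite codimension, and the
    Hahn-Banach theorem for finitely many vectors. *)

Require Import Defs.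
From HB Require Import structures.
From mathcomp Require Import all_boot all_order all_algebra.
From mathcomp Require Import complex.
From mathcomp Require Import all_classical all_reals all_analysis.
From mathcomp Require Import ring lra zify.

Set Implicit Arguments.
Unset Strict Implicit.
Unset Printing Implicit Defensive.

Import Order.TTheory GRing.Theory Num.Theory.
Import numFieldNormedType.Exports.

Local Open Scope classical_set_scope.
Local Open Scope complex_scope.
Local Open Scope ring_scope.

(** * Dimensions of quotients *)

Section QuotientDimension.
Context {R : realType}.
Implicit Types V : lmodType R[i].

Definition lin_subspace V (W : set V) :=
  W 0 /\ forall (a : R[i]) x y, W x -> W y -> W (a *: x + y).

Definition free_mod V (W : set V) (m : nat) (f : 'I_m -> V) :=
  forall c : 'I_m -> R[i], W (\sum_(i < m) c i *: f i) -> forall i, c i = 0.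

Lemma subspace0 V : lin_subspace [set (0 : V)].
Proof. by split=> // a x y /= -> ->; rewrite scaler0 addr0. Qed.

Lemma subspaceT V : lin_subspace [set: V].
Proof. by []. Qed.

Section Subspace.
Context {V : lmodType R[i]} (W : set V) (sW : lin_subspace W).

Lemma subspaceD x y : W x -> W y -> W (x + y).
Proof. by move=> Wx Wy; rewrite -[x]scale1r; apply: sW.2. Qed.

Lemma subspaceZ a x : W x -> W (a *: x).
Proof. by move=> Wx; rewrite -[a *: x]addr0; apply: sW.2 => //; apply: sW.1. Qed.

Lemma subspaceN x : W x -> W (- x).
Proof. by move=> Wx; rewrite -scaleN1r; apply: subspaceZ. Qed.

Lemma subspaceB x y : W x -> W y -> W (x - y).
Proof. by move=> Wx Wy; apply: subspaceD => //; apply: subspaceN. Qed.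

Lemma subspace_sum m (c : 'I_m -> R[i]) (f : 'I_m -> V) :
  (forall i, W (f i)) -> W (\sum_(i < m) c i *: f i).
Proof.
move=> Wf; apply: (big_ind W); [exact: sW.1|exact: subspaceD|].
by move=> i _; apply: subspaceZ.
Qed.

End Subspace.

Lemma left_kernel_vector (m n : nat) (A : 'M[R[i]]_(m, n)) :
  (n < m)%N -> exists2 u : 'rV[R[i]]_m, u != 0 & u *m A = 0.
Proof.
move=> nm; have : kermx A != 0.
  rewrite -mxrank_eq0 mxrank_ker subn_eq0 -ltnNge.
  exact: leq_ltn_trans (rank_leq_col A) nm.
case/rowV0Pn => u /sub_kermxP uA u0; by exists u.
Qed.

(** Steinitz bound: if [n < m], the [m] by [n] coordinate matrix has a nonzero left kernel vector,
    which combines the [f j] into an element of [W]. *)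
Lemma free_mod_le V (W : set V) (m n : nat) (e : 'I_n -> V) (f : 'I_m -> V) :
  lin_subspace W -> free_mod W f ->
  (forall j, exists c : 'I_n -> R[i], W (f j - \sum_(i < n) c i *: e i)) ->
  (m <= n)%N.
Proof.
move=> sW ff /choice[c Wc]; rewrite leqNgt; apply/negP => nm.
have [u u0 uc] := left_kernel_vector (\matrix_(j, i) c j i) nm.
case/eqP: u0; apply/rowP => j; rewrite mxE; move: j.
apply: (ff (fun j => u 0 j)).
have -> : \sum_(j < m) u 0 j *: f j =
    \sum_(j < m) u 0 j *: (f j - \sum_(i < n) c j i *: e i).
  have z : \sum_(j < m) u 0 j *: (\sum_(i < n) c j i *: e i) = 0.
    under eq_bigr do rewrite scaler_sumr.
    rewrite exchange_big big1// => i _.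
    under eq_bigr do rewrite scalerA.
    rewrite -scaler_suml; move/rowP: uc => /(_ i); rewrite !mxE.
    by under eq_bigr do rewrite mxE; move=> ->; rewrite scale0r.
  under [RHS]eq_bigr do rewrite scalerBr.
  by rewrite sumrB z subr0.
exact: subspace_sum.
Qed.

Lemma free_mod_quotient_le V (U W : set V) (m n : nat) (f : 'I_m -> V) :
  lin_subspace W -> quotient_dim U W n -> (forall i, U (f i)) -> free_mod W f ->
  (m <= n)%N.
Proof.
move=> sW [e [Ue fe se]] Uf ff.
by apply: (free_mod_le (e := e) sW ff) => j; apply: se.
Qed.

Lemma quotient_dim_uniq V (U W : set V) (m n : nat) :
  lin_subspace W -> quotient_dim U W m -> quotient_dim U W n -> m = n.
Proof.
move=> sW Um Un; apply/eqP; rewrite eqn_leq; apply/andP; split.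
  by case: Um => e [Ue fe _]; exact: free_mod_quotient_le sW Un Ue fe.
by case: Un => e [Ue fe _]; exact: free_mod_quotient_le sW Um Ue fe.
Qed.

Lemma dim_quotientE V (U W : set V) (n : nat) :
  lin_subspace W -> quotient_dim U W n -> dim_quotient U W = n.
Proof.
by move=> sW Un; apply: (quotient_dim_uniq sW _ Un); exact: (xgetI _ Un).
Qed.

(** A free family of maximal length spans [U] modulo [W]. A mere bound on free families thus yields
    a dimension, without exhibiting a basis. *)
Lemma quotient_dim_exists V (U W : set V) (n : nat) :
  lin_subspace W ->
  (forall m (f : 'I_m -> V), (forall i, U (f i)) -> free_mod W f ->
    (m <= n)%N) ->
  exists2 m, (m <= n)%N & quotient_dim U W m.
Proof.
move=> sW bnd.
pose P m := `[< exists f : 'I_m -> V, (forall i, U (f i)) /\ free_mod W f >].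
have P0 : exists m, P m.
  by exists 0%N; apply/asboolP; exists (fun=> 0); split=> [[]|c _ []].
have Pn m : P m -> (m <= n)%N by case/asboolP => f [Uf ff]; apply: bnd ff.
case: (ex_maxnP P0 Pn) => m Pm mmax; exists m; first exact: Pn.
case/asboolP: Pm => f [Uf ff]; exists f; split=> // u Uu.
apply: contrapT => nspan.
suff : P m.+1 by move/mmax; rewrite ltnn.
(* [u] is put in front of [f]; a nonzero coefficient of [u] would place it in the span of [f] modulo
   [W]. *)
apply/asboolP; exists (fun i => if unlift ord0 i is Some j then f j else u).
split=> [i|c]; first by case: unliftP.
rewrite big_ord_recl unlift_none.
under eq_bigr do rewrite liftK.
move=> Wc.
have c0 : c ord0 = 0.
  apply: contrapT => /eqP c0; apply: nspan.
  exists (fun i => - ((c ord0)^-1 * c (lift ord0 i))).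
  have := subspaceZ sW (c ord0)^-1 Wc.
  rewrite scalerDr scalerA mulVf// scale1r scaler_sumr.
  congr (W (_ + _)); rewrite -sumrN; apply: eq_bigr => i _.
  by rewrite scalerA scaleNr opprK.
move: Wc; rewrite c0 scale0r add0r => /ff cl i.
by case: (unliftP ord0 i) => [j ->|->].
Qed.

Lemma quotient_dimD V (U U' W : set V) (m n : nat) :
  lin_subspace W -> W `<=` U' -> U' `<=` U -> lin_subspace U' ->
  quotient_dim U U' m -> quotient_dim U' W n -> quotient_dim U W (m + n).
Proof.
move=> sW WU' U'U sU' [e [Ue fe se]] [f [Uf ff sf]].
exists (fun i => match fintype.split i with inl j => e j | inr j => f j end); split.
- by move=> i; case: fintype.split => j //; apply/U'U/Uf.
- move=> c; rewrite big_split_ord/=.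
  under eq_bigr do rewrite (unsplitK (inl _)).
  under [X in _ + X]eq_bigr do rewrite (unsplitK (inr _)).
  move=> Wc.
  have ce : forall i, c (lshift n i) = 0.
    apply: fe.
    have /(subspaceB sU' (WU' _ Wc)) : U' (\sum_(i < n) c (rshift m i) *: f i).
      exact: subspace_sum.
    by rewrite addrK.
  have cf : forall i, c (rshift m i) = 0.
    by apply: ff; move: Wc; rewrite big1 ?add0r// => i _; rewrite ce scale0r.
  by move=> i; case: (split_ordP i) => j ->.
- move=> u /se[c /[dup] Uc /sf[d Wd]].
  exists (fun i => match fintype.split i with inl j => c j | inr j => d j end).
  rewrite big_split_ord/=.
  under eq_bigr do rewrite (unsplitK (inl _)).
  under [X in _ - (_ + X)]eq_bigr do rewrite (unsplitK (inr _)).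
  by rewrite opprD addrA.
Qed.

(** A family free modulo [U'] is free modulo [W], and a family in [U'] lies in [U]. So [n] bounds
    both dimensions; additivity and uniqueness then give the sum. *)
Lemma quotient_dim_sub V (U U' W : set V) (n : nat) :
  lin_subspace W -> W `<=` U' -> U' `<=` U -> lin_subspace U' ->
  quotient_dim U W n ->
  exists p q, [/\ quotient_dim U U' p, quotient_dim U' W q & n = (p + q)%N].
Proof.
move=> sW WU' U'U sU' UW.
have [|p _ Up] := @quotient_dim_exists _ U U' n sU'.
  move=> m f Uf ff; apply: free_mod_quotient_le UW Uf _ => // c /WU'.
  exact: ff.
have [|q _ Uq] := @quotient_dim_exists _ U' W n sW.
  move=> m f Uf ff; apply: free_mod_quotient_le UW _ ff => // i.
  exact/U'U/Uf.
exists p, q; split=> //; apply: (quotient_dim_uniq sW UW).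
exact: (quotient_dimD sW WU' U'U sU' Up Uq).
Qed.

Section Iso.
Context {V V' : lmodType R[i]} (phi : V -> V') (U W : set V) (U' W' : set V').
Hypotheses (phi_lin : linear phi) (sU : lin_subspace U) (sW' : lin_subspace W').
Hypotheses (phiU : forall u, U u -> U' (phi u))
  (phiW : forall u, U u -> W' (phi u) <-> W u)
  (phi_onto : forall v, U' v -> exists2 u, U u & W' (v - phi u)).

Let phi_sum n (c : 'I_n -> R[i]) (e : 'I_n -> V) :
  phi (\sum_(i < n) c i *: e i) = \sum_(i < n) c i *: phi (e i).
Proof.
pose phiL := GRing.isLinear.Build _ _ _ _ phi phi_lin.
pose f : {linear V -> V'} := HB.pack phi phiL.
by rewrite -[phi]/(f : V -> V') linear_sum; apply: eq_bigr => i _; rewrite linearZ.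
Qed.

Let phiB x y : phi (x - y) = phi x - phi y.
Proof. by rewrite addrC -scaleN1r phi_lin scaleN1r addrC. Qed.

(** The hypotheses of the section say that [phi] induces an isomorphism from [U] modulo [W] onto
    [U'] modulo [W']; [phi] itself may be neither injective nor onto. *)
Lemma quotient_dim_image n : quotient_dim U W n -> quotient_dim U' W' n.
Proof.
move=> [e [Ue fe se]]; exists (phi \o e); split=> [i|c|v /phi_onto[u Uu Wv]].
- exact/phiU/Ue.
- by rewrite -phi_sum phiW; [exact: fe|exact: subspace_sum].
have [c Wc] := se _ Uu; exists c.
rewrite -phi_sum -[v](subrK (phi u)) -addrA -phiB.
apply: subspaceD => //; apply/phiW => //.
by apply: subspaceB => //; apply: subspace_sum.
Qed.

Lemma quotient_dim_preimage n : quotient_dim U' W' n -> quotient_dim U W n.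
Proof.
move=> [e [Ue fe se]].
have /choice[g Pg] : forall i, exists u, U u /\ W' (e i - phi u).
  by move=> i; have [u] := phi_onto (Ue i); exists u.
have sumg (c : 'I_n -> R[i]) :
    W' (\sum_(i < n) c i *: e i - phi (\sum_(i < n) c i *: g i)).
  rewrite phi_sum -sumrB.
  under eq_bigr do rewrite -scalerBr.
  by apply: subspace_sum => // i; apply: (Pg i).2.
have Ug (c : 'I_n -> R[i]) : U (\sum_(i < n) c i *: g i).
  by apply: subspace_sum => // i; apply: (Pg i).1.
exists g; split=> [i|c|u Uu]; first exact: (Pg i).1.
- move/phiW => /(_ (Ug c)) Wc; apply: fe.
  by have := subspaceD sW' (sumg c) Wc; rewrite subrK.
have [c Wc] := se _ (phiU Uu); exists c; apply/phiW.
  by apply: subspaceB => //; apply: subspace_sum => // i; apply: (Pg i).1.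
rewrite phiB; have := subspaceD sW' Wc (sumg c).
by rewrite addrA subrK.
Qed.

End Iso.
End QuotientDimension.

(** * Norms and geometrically convergent sequences *)

Section FastConvergence.
Context {R : realType}.

(** The [R[i]]-valued norm brought to [R], where the order is total and [lra] applies. *)
Definition rnorm (V : normedZmodType R[i]) (v : V) : R := complex.Re `|v|.

Section RealNorm.
Context {V : normedZmodType R[i]}.
Implicit Types v w : V.

Lemma rnormE v : (rnorm v)%:C = `|v|.
Proof. exact: normC_Re. Qed.

Lemma rnorm_ge0 v : 0 <= rnorm v.
Proof. by rewrite -ler0c rnormE. Qed.

Lemma rnorm0 : rnorm (0 : V) = 0.
Proof. by rewrite /rnorm normr0. Qed.

Lemma rnormN v : rnorm (- v) = rnorm v.
Proof. by rewrite /rnorm normrN. Qed.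

Lemma rdistC v w : rnorm (v - w) = rnorm (w - v).
Proof. by rewrite -rnormN opprB. Qed.

Lemma rnormD v w : rnorm (v + w) <= rnorm v + rnorm w.
Proof. by rewrite -lecR rmorphD/= !rnormE ler_normD. Qed.

Lemma rnormB v w : rnorm (v - w) <= rnorm v + rnorm w.
Proof. by rewrite (le_trans (rnormD _ _))// rnormN. Qed.

Lemma rdistD z v w : rnorm (v - w) <= rnorm (v - z) + rnorm (z - w).
Proof. by rewrite (le_trans _ (rnormD _ _))// addrA subrK. Qed.

Lemma rnorm_eq0 v : (rnorm v == 0) = (v == 0).
Proof. by rewrite -(inj_eq (@complexI R)) rnormE normr_eq0. Qed.

Lemma rnorm_le0 v : rnorm v <= 0 -> v = 0.
Proof. by move=> v0; apply/eqP; rewrite -rnorm_eq0 eq_le v0 rnorm_ge0. Qed.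

Lemma rnorm_gt0 v : v != 0 -> 0 < rnorm v.
Proof. by move=> v0; rewrite lt_def rnorm_eq0 v0 rnorm_ge0. Qed.

End RealNorm.

Lemma rnormM (a b : R[i]) : rnorm (a * b) = rnorm a * rnorm b.
Proof. by apply: complexI; rewrite rmorphM/= !rnormE normrM. Qed.

Lemma rnormX (a : R[i]) n : rnorm (a ^+ n) = rnorm a ^+ n.
Proof. by apply: complexI; rewrite rmorphXn/= !rnormE normrX. Qed.

Lemma rnormC (r : R) : 0 <= r -> rnorm (r%:C) = r.
Proof. by move=> r0; rewrite /rnorm ger0_norm ?ler0c. Qed.

Lemma rnormV (a : R[i]) : rnorm (a^-1) = (rnorm a)^-1.
Proof. by apply: complexI; rewrite fmorphV/= !rnormE normfV. Qed.

Lemma rnormZ (V : normedModType R[i]) (a : R[i]) (v : V) :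
  rnorm (a *: v) = rnorm a * rnorm v.
Proof. by apply: complexI; rewrite rmorphM/= !rnormE normrZ. Qed.

Lemma rnorm_bounded_op (X Y : normedModType R[i]) (f : bounded_op X Y) x :
  rnorm (f x) <= opnorm f * rnorm x.
Proof. by rewrite -lecR rmorphM/= !rnormE ler_opnorm. Qed.

Lemma bounded_linear_rnorm (X Y : normedModType R[i]) (f : X -> Y) (K : R) :
  linear f -> (forall x, rnorm (f x) <= K * rnorm x) ->
  f \in @bounded_linear R X Y.
Proof.
move=> lf fK; apply/bounded_linearP; split=> //; exists (K%:C) => x.
by rewrite -!rnormE -rmorphM/= lecR.
Qed.

Lemma opnorm_le_rnorm (X Y : normedModType R[i]) (f : bounded_op X Y) (K : R) :
  0 <= K -> (forall x, rnorm (f x) <= K * rnorm x) -> opnorm f <= K.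
Proof.
move=> K0 fK; apply: opnorm_le => // x.
by rewrite -!rnormE -rmorphM/= lecR.
Qed.

Lemma geometric_lt (K e : R) : 0 < e -> exists n, K / 2 ^+ n < e.
Proof.
move=> e0; exists (Num.bound (`|K| / e)); set n := Num.bound _.
rewrite ltr_pdivrMr ?exprn_gt0// mulrC -ltr_pdivrMr//.
apply: (@le_lt_trans _ _ (`|K| / e)).
  by rewrite ler_pM2r ?invr_gt0// ler_norm.
apply: lt_le_trans (archi_boundP _) _; first by rewrite divr_ge0// ltW.
by rewrite -natrX ler_nat ltnW// ltn_expl.
Qed.

Lemma geometric_le0 (a K : R) : (forall n, a <= K / 2 ^+ n) -> a <= 0.
Proof.
move=> aK; rewrite leNgt; apply/negP => /(geometric_lt K)[n].
by rewrite ltNge aK.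
Qed.

Section FastCvg.
Context {V : normedModType R[i]}.
Implicit Types (u v : nat -> V) (l : V).

Definition fast_cvg u l := exists K : R, forall n, rnorm (u n - l) <= K / 2 ^+ n.

Lemma fast_cvg_uniq u l l' : fast_cvg u l -> fast_cvg u l' -> l = l'.
Proof.
move=> [K uK] [K' uK']; apply/eqP; rewrite -subr_eq0; apply/eqP/rnorm_le0.
apply: (@geometric_le0 _ (K + K')) => n.
by rewrite (le_trans (rdistD (u n) _ _))// mulrDl lerD// rdistC.
Qed.

Lemma fast_cvg_cst l : fast_cvg (fun=> l) l.
Proof. by exists 0 => n; rewrite subrr rnorm0 mul0r. Qed.

Lemma fast_cvgD u v l l' : fast_cvg u l -> fast_cvg v l' ->
  fast_cvg (fun n => u n + v n) (l + l').
Proof.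
move=> [K uK] [K' vK]; exists (K + K') => n.
by rewrite opprD addrACA (le_trans (rnormD _ _))// mulrDl lerD.
Qed.

Lemma fast_cvgZ (a : R[i]) u l :
  fast_cvg u l -> fast_cvg (fun n => a *: u n) (a *: l).
Proof.
move=> [K uK]; exists (rnorm a * K) => n.
by rewrite -scalerBr rnormZ -mulrA ler_wpM2l// rnorm_ge0.
Qed.

Lemma fast_cvgB u v l l' : fast_cvg u l -> fast_cvg v l' ->
  fast_cvg (fun n => u n - v n) (l - l').
Proof.
move=> ul /(fast_cvgZ (-1)) vl; move: (fast_cvgD ul vl); rewrite scaleN1r.
by under eq_fun do rewrite scaleN1r.
Qed.

Lemma fast_cvgS u l : fast_cvg u l -> fast_cvg (fun n => u n.+1) l.
Proof.
move=> [K uK]; exists (K / 2) => n; rewrite (le_trans (uK n.+1))//.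
by rewrite exprS invfM mulrA.
Qed.

(** The subtracted tail makes the induction exact, since [K / 2^k = 2K / 2^k - 2K / 2^(k+1)]. *)
Lemma telescope_rnorm (K : R) u n m :
  (forall n, rnorm (u n.+1 - u n) <= K / 2 ^+ n) ->
  rnorm (u n - u (n + m)%N) <= 2 * K / 2 ^+ n - 2 * K / 2 ^+ (n + m).
Proof.
move=> uK; elim: m => [|m IH]; first by rewrite addn0 !subrr rnorm0.
rewrite (le_trans (rdistD (u (n + m)%N) _ _))//.
have := uK (n + m)%N; rewrite (rdistC (u _.+1)) addnS.
move: IH; rewrite exprS invfM; set t := (2 ^+ (n + m))^-1; lra.
Qed.

(** Letting [m] grow in the telescoped bound replaces the unknown constant hidden in [fast_cvg] by
    the explicit [2 * K]. *)
Lemma fast_cvg_rdist (K : R) u l :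
  (forall n, rnorm (u n.+1 - u n) <= K / 2 ^+ n) -> fast_cvg u l ->
  forall n, rnorm (u n - l) <= 2 * K / 2 ^+ n.
Proof.
move=> uK [K' uK'] n.
have tele m := telescope_rnorm n m uK.
rewrite -subr_le0; apply: (@geometric_le0 _ (2 * `|K| + `|K'|)) => m.
rewrite lerBlDr (le_trans (rdistD (u (n + m)%N) _ _))//.
rewrite (le_trans (lerD (tele _) (uK' _)))//.
have t0 : 0 < (2 ^+ (n + m) : R)^-1 by rewrite invr_gt0 exprn_gt0.
have tm : (2 ^+ (n + m) : R)^-1 <= (2 ^+ m)^-1.
  by rewrite lef_pV2 ?posrE ?exprn_gt0// ler_weXn2l ?ler1n// leq_addl.
rewrite [leRHS]addrC -addrA lerD2l mulrDl.
have K0 := ler_norm (- K); have K'0 := ler_norm K'; rewrite normrN in K0.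
apply: (@le_trans _ _ ((2 * `|K| + `|K'|) / 2 ^+ (n + m))).
  by have := ler_wpM2r (ltW t0) K0; have := ler_wpM2r (ltW t0) K'0; lra.
by rewrite ler_wpM2l// addr_ge0// mulr_ge0.
Qed.

End FastCvg.

Lemma fast_cvg_op (X Y : normedModType R[i]) (f : bounded_op X Y) u l :
  fast_cvg u l -> fast_cvg (fun n => f (u n)) (f l).
Proof.
move=> [K uK]; exists (opnorm f * K) => n.
rewrite -linearB (le_trans (rnorm_bounded_op _ _))// -mulrA.
by apply: ler_wpM2l; [exact: opnorm_ge0|exact: uK].
Qed.

(* All limits below are of geometrically convergent sequences, so this weak
   form of completeness is the only one needed. *)
Definition fast_complete (V : normedModType R[i]) :=
  forall (u : nat -> V) (K : R),
    (forall n, rnorm (u n.+1 - u n) <= K / 2 ^+ n) -> exists l, fast_cvg u l.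

Lemma completeNormedMod_fast_complete (V : completeNormedModType R[i]) :
  fast_complete V.
Proof.
move=> u K uK.
have K0 : 0 <= K.
  by have := uK 0%N; rewrite expr0 divr1; apply: le_trans; exact: rnorm_ge0.
have tele n m : rnorm (u n - u (n + m)%N) <= 2 * K / 2 ^+ n.
  rewrite (le_trans (telescope_rnorm n m uK))// gerBl.
  by rewrite divr_ge0 ?mulr_ge0// exprn_ge0.
have cu : cauchy (u @ \oo).
  apply: cauchy_exP => e e0.
  have e0' : 0 < complex.Re e by rewrite -ltcR RRe_real// gtr0_real.
  have [n ne] := geometric_lt (2 * K) e0'.
  exists (u n); exists n => // m /= /subnKC <-.
  rewrite -ball_normE/=.
  have -> : e = (complex.Re e)%:C by rewrite RRe_real// gtr0_real.
  by rewrite -rnormE ltcR (le_lt_trans (tele _ _)).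
have cvu : cvg (u @ \oo) by exact: cauchy_cvg.
have /cvgrPdist_lt ul : u @ \oo --> lim (u @ \oo) := cvu.
exists (lim (u @ \oo)), (2 * K) => n.
(* If the limit were farther than the bound, late terms would be closer to it than the excess,
   against [tele]. *)
rewrite leNgt; apply/negP; rewrite -subr_gt0 -ltcR => /ul[N _ NP].
have := NP (n + N)%N (leq_addl _ _).
rewrite -rnormE ltcR; apply/negP; rewrite -leNgt.
have := rdistD (u (n + N)%N) (u n) (lim (u @ \oo)).
have := tele n N; rewrite (rdistC (lim _)); lra.
Qed.

End FastConvergence.

(** * Completeness of the scalars, of products and of operator spaces *)

Section Completeness.
Context {R : realType}.

(** The intervals of radius [2 * K / 2 ^+ n] around [u n] are nested; the limit is the supremum of
    their left ends. *)
Lemma real_fast_complete (u : nat -> R) (K : R) :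
  (forall n, `|u n.+1 - u n| <= K / 2 ^+ n) ->
  exists l, forall n, `|u n - l| <= 2 * K / 2 ^+ n.
Proof.
move=> uK.
have K0 : 0 <= K.
  by have := uK 0%N; rewrite expr0 divr1; exact: le_trans.
have step n m : u (n + m)%N - 2 * K / 2 ^+ (n + m) >= u n - 2 * K / 2 ^+ n /\
    u (n + m)%N + 2 * K / 2 ^+ (n + m) <= u n + 2 * K / 2 ^+ n.
  elim: m => [|m IH]; first by rewrite addn0.
  have := uK (n + m)%N; rewrite ler_distl addnS.
  by move: IH; rewrite exprS invfM; set t := (2 ^+ (n + m))^-1; lra.
have p n : 0 <= 2 * K / 2 ^+ n by rewrite divr_ge0 ?mulr_ge0 ?exprn_ge0.
have ub n m : u m - 2 * K / 2 ^+ m <= u n + 2 * K / 2 ^+ n.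
  have [/subnKC <-|/ltnW/subnKC <-] := leqP n m.
    by have := step n (m - n)%N; have := p (n + (m - n))%N; lra.
  by have := step m (n - m)%N; have := p (m + (n - m))%N; lra.
pose A := [set u m - 2 * K / 2 ^+ m | m in [set: nat]].
exists (sup A) => n; rewrite ler_distl; apply/andP; split.
  rewrite lerBlDr; apply: ge_sup; first by exists (u 0%N - 2 * K / 2 ^+ 0), 0%N.
  by move=> _ [m _ <-]; apply: ub.
rewrite -lerBlDr.
by apply: ub_le_sup; [exists (u n + 2 * K / 2 ^+ n) => _ [m _ <-]|exists n].
Qed.

Lemma rnorm_complex (z : R[i]) :
  rnorm z = Num.sqrt (complex.Re z ^+ 2 + complex.Im z ^+ 2).
Proof. by rewrite /rnorm normc_def. Qed.

Lemma normr_Re_le (z : R[i]) : `|complex.Re z| <= rnorm z.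
Proof. by rewrite rnorm_complex -sqrtr_sqr ler_wsqrtr// lerDl sqr_ge0. Qed.

Lemma normr_Im_le (z : R[i]) : `|complex.Im z| <= rnorm z.
Proof. by rewrite rnorm_complex -sqrtr_sqr ler_wsqrtr// lerDr sqr_ge0. Qed.

Lemma rnorm_complex_le (z : R[i]) :
  rnorm z <= `|complex.Re z| + `|complex.Im z|.
Proof.
rewrite rnorm_complex -[leRHS]ger0_norm ?addr_ge0// -sqrtr_sqr ler_wsqrtr//.
rewrite sqrrD !real_normK ?num_real// addrAC lerDl.
by rewrite mulrn_wge0// mulr_ge0.
Qed.

Lemma complex_fast_complete : fast_complete (R[i]^o : normedModType R[i]).
Proof.
move=> u K uK.
have [n|a ua] := @real_fast_complete (fun n => complex.Re (u n)) K.
  by apply: le_trans (uK n); rewrite -raddfB; exact: normr_Re_le.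
have [n|b ub] := @real_fast_complete (fun n => complex.Im (u n)) K.
  by apply: le_trans (uK n); rewrite -raddfB; exact: normr_Im_le.
exists (a +i* b)%C, (4 * K) => n.
apply: (le_trans (rnorm_complex_le _)); rewrite !raddfB/=.
by apply: le_trans (lerD (ua n) (ub n)) _; lra.
Qed.

Section Product.
Context {X Y : normedModType R[i]}.
Implicit Types z : X * Y.

Lemma rnorm_fst z : rnorm z.1 <= rnorm z.
Proof.
rewrite -lecR !rnormE [leRHS]prod_normE comparable_le_max ?lexx//.
by rewrite real_comparable.
Qed.

Lemma rnorm_snd z : rnorm z.2 <= rnorm z.
Proof.
rewrite -lecR !rnormE [leRHS]prod_normE comparable_le_max ?lexx ?orbT//.
by rewrite real_comparable.
Qed.

Lemma rnorm_pair_le z : rnorm z <= rnorm z.1 + rnorm z.2.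
Proof.
rewrite -lecR rmorphD/= !rnormE [leLHS]prod_normE.
by rewrite comparable_ge_max ?real_comparable// lerDl lerDr !normr_ge0.
Qed.

Lemma prod_fast_complete : fast_complete X -> fast_complete Y ->
  fast_complete (X * Y)%type.
Proof.
move=> cX cY u K uK.
have [n|a [Ka ua]] := cX (fun n => (u n).1) K.
  by apply: le_trans (uK n); exact: (rnorm_fst (u n.+1 - u n)).
have [n|b [Kb ub]] := cY (fun n => (u n).2) K.
  by apply: le_trans (uK n); exact: (rnorm_snd (u n.+1 - u n)).
exists (a, b), (Ka + Kb) => n.
apply: (le_trans (rnorm_pair_le _)); rewrite mulrDl.
by apply: lerD; [exact: ua|exact: ub].
Qed.

(** Limits are taken pointwise. The constant at [x] is [K * rnorm x], so the pointwise estimates add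
    up to one in operator norm. *)
Lemma op_fast_complete : fast_complete Y -> fast_complete (bounded_op X Y).
Proof.
move=> cY u K uK.
have K0 : 0 <= K.
  have := uK 0%N; rewrite expr0 divr1; apply: le_trans; exact: opnorm_ge0.
have uKx x n : rnorm (u n.+1 x - u n x) <= K * rnorm x / 2 ^+ n.
  rewrite -bounded_opBE (le_trans (rnorm_bounded_op _ _))// mulrAC.
  by rewrite ler_wpM2r ?rnorm_ge0//; exact: uK.
have /choice[l lP] x := cY _ _ (uKx x).
have ul x n := fast_cvg_rdist (uKx x) (lP x) n.
have lin : linear l.
  move=> a x y; apply: fast_cvg_uniq (lP _) _.
  under [fun n => u n _]eq_fun do rewrite linearP.
  exact: (fast_cvgD (fast_cvgZ _ (lP x)) (lP y)).
have bl : l \in @bounded_linear R X Y.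
  apply: (@bounded_linear_rnorm _ _ _ _ (opnorm (u 0%N) + 2 * K)) => // x.
  have := ul x 0%N; rewrite expr0 divr1.
  have := rnorm_bounded_op (u 0%N) x.
  have := rdistD (u 0%N x) (l x) 0; rewrite !subr0 (rdistC (l x)).
  by rewrite mulrDl; lra.
exists (BoundedOp bl), (2 * K) => n; apply: opnorm_le_rnorm.
  by rewrite divr_ge0 ?mulr_ge0 ?exprn_ge0.
by move=> x /=; rewrite mulrAC -(mulrA 2); apply: ul.
Qed.

End Product.

Lemma dual_fast_complete (X : normedModType R[i]) : fast_complete (dual X).
Proof. exact: (op_fast_complete complex_fast_complete). Qed.

End Completeness.

(** * Open mapping theorem *)

Section OpenMapping.
Context {R : realType}.

Section Surjective.
Context {X Y : normedModType R[i]} (T : bounded_op X Y).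
Hypotheses (cX : fast_complete X) (cY : fast_complete Y)
  (T_onto : forall y, exists x, y = T x).

(* Baire's category argument, by nested balls. *)
Let dense_ball : exists (y0 : Y) (r N : R), 0 < r /\
  forall y, rnorm (y - y0) < r -> forall e, 0 < e ->
    exists2 z, rnorm z <= N & rnorm (y - T z) <= e.
Proof.
apply: contrapT => H.
(* [p] holds a stage number, a centre and a radius. If the claim fails, its ball contains a smaller
   one whose centre is at least the new radius away from the image of the ball of radius [p.1]. *)
have /choice[s sP] (p : nat * (Y * R)) : exists q : Y * R, 0 < p.2.2 ->
    [/\ rnorm (q.1 - p.2.1) <= p.2.2 / 4, 0 < q.2 <= p.2.2 / 2
      & forall z, rnorm z <= p.1%:R -> q.2 <= rnorm (q.1 - T z)].
  case: p => n [y0 r] /=; have [r0|] := boolP (0 < r); last by exists (0, 0).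
  apply: contrapT => nq; apply: H; exists y0, (r / 4), n%:R.
  split=> [|y yr e e0]; first by rewrite divr_gt0.
  apply: contrapT => nz; apply: nq; exists (y, Num.min e (r / 2)) => _ /=.
  split=> [||z zn]; first exact: ltW.
    by rewrite lt_min e0 divr_gt0//= ge_min lexx orbT.
  rewrite ge_min; apply/orP; left; rewrite leNgt; apply/negP => /ltW ze.
  by apply: nz; exists z.
pose fix st n : Y * R := if n is n'.+1 then s (n', st n') else (0, 1).
have st0 n : 0 < (st n).2.
  by elim: n => [|n IH]//=; have [] := sP (n, st n) IH => _ /andP[].
have stP n := sP (n, st n) (st0 n).
have stle n m : (st (n + m)%N).2 <= (st n).2 / 2 ^+ m.
  elim: m => [|m IH]; first by rewrite addn0 expr0 divr1.
  rewrite addnS; have [_ /andP[_ h] _] := stP (n + m)%N.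
  by apply: le_trans h _; rewrite exprSr invfM mulrA ler_pM2r// invr_gt0.
have step n m : rnorm ((st (n + m.+1)%N).1 - (st (n + m)%N).1) <=
    (st n).2 / 4 / 2 ^+ m.
  have [+ _ _] := stP (n + m)%N; rewrite addnS => /le_trans; apply => /=.
  by rewrite mulrAC ler_pM2r ?invr_gt0//; apply: stle.
have [l lP] := cY (step 0%N).
have lr n : rnorm ((st n).1 - l) <= (st n).2 / 2.
  have [K lK] := lP.
  have ln : fast_cvg (fun m => (st (n + m)%N).1) l.
    exists (`|K|) => m; apply: le_trans (lK (n + m)%N) _.
    apply: (@le_trans _ _ (`|K| / 2 ^+ (n + m))).
      by rewrite ler_pM2r ?invr_gt0 ?exprn_gt0// ler_norm.
    rewrite ler_wpM2l// lef_pV2 ?posrE ?exprn_gt0//.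
    by rewrite ler_weXn2l ?ler1n// leq_addl.
  have := fast_cvg_rdist (step n) ln 0%N; rewrite addn0 expr0 divr1.
  by move=> /le_trans; apply; lra.
(* At a stage [n] beyond [rnorm z], the next centre is at least one radius away from [T z], yet
   within half a radius of [l = T z]. *)
have [z lz] := T_onto l.
pose n := Num.bound (rnorm z).
have [_ _ /(_ z)] := stP n; rewrite -lz => /(_ (ltW (archi_boundP (rnorm_ge0 z)))).
by have := lr n.+1; have := st0 n.+1 => /=; lra.
Qed.

Let half_solution : exists2 N : R, 0 <= N & forall y,
  exists2 z, rnorm z <= N * rnorm y & rnorm (y - T z) <= rnorm y / 2.
Proof.
have [y0 [r [N [r0 H]]]] := dense_ball.
have N0 : 0 <= N.
  have [||z zN _] := H y0 _ 1; rewrite ?subrr ?rnorm0//.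
  exact: le_trans (rnorm_ge0 z) zN.
exists (4 * N / r) => [|y]; first by rewrite divr_ge0 ?mulr_ge0// ltW.
have [->|y0'] := eqVneq y 0.
  by exists 0; rewrite ?(raddf0 T) ?subr0 !rnorm0 ?mulr0 ?mul0r.
have ny : 0 < rnorm y := rnorm_gt0 y0'.
(* With this scale [y0 + t *: y] stays in the ball. Approximating it and [y0] within [r / 8] each
   approximates [t *: y] within [r / 4], half of its norm. *)
pose t := r / (2 * rnorm y).
have t0 : 0 < t by rewrite divr_gt0 ?mulr_gt0.
have nt : rnorm (t%:C) = t by rewrite rnormC ?ltW.
have tC : t%:C != 0 :> R[i] by rewrite -rnorm_eq0 nt gt_eqF.
have [||z1 z1N z1e] := H (y0 + t%:C *: y) _ (r / 8).
- rewrite addrC addKr rnormZ nt /t.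
  suff -> : r / (2 * rnorm y) * rnorm y = r / 2 by lra.
  by field; rewrite gt_eqF.
- by rewrite divr_gt0.
have [||z2 z2N z2e] := H y0 _ (r / 8).
- by rewrite subrr rnorm0.
- by rewrite divr_gt0.
exists ((t%:C)^-1 *: (z1 - z2)).
- rewrite rnormZ rnormV nt ler_pdivrMl//.
  apply: le_trans (rnormB _ _) _.
  suff -> : t * (4 * N / r * rnorm y) = N + N by exact: lerD.
  by rewrite /t; field; rewrite !gt_eqF.
- have -> : y - T ((t%:C)^-1 *: (z1 - z2)) =
      (t%:C)^-1 *: (y0 + t%:C *: y - T z1 - (y0 - T z2)).
    rewrite linearZZ linearB -[y in LHS](scalerK tC) -scalerBr; congr (_ *: _).
    by rewrite !opprB [RHS]addrC -[in RHS](addrA y0) addrA subrK addrCA.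
  rewrite rnormZ rnormV nt ler_pdivrMl//.
  apply: le_trans (rnormB _ _) _; apply: le_trans (lerD z1e z2e) _.
  suff -> : t * (rnorm y / 2) = r / 4 by lra.
  by rewrite /t; field; rewrite gt_eqF.
Qed.

(** Solving repeatedly for the remaining error halves it each time; the corrections form a geometric
    series of total norm at most [2 * N * rnorm y]. *)
Lemma open_mapping : exists2 K : R, 0 <= K &
  forall y, exists2 x, y = T x & rnorm x <= K * rnorm y.
Proof.
have [N N0 H] := half_solution.
have /choice[phi phiP] y : exists z, rnorm z <= N * rnorm y /\
    rnorm (y - T z) <= rnorm y / 2 by have [z] := H y; exists z.
have phiN y := (phiP y).1; have phiH y := (phiP y).2.
exists (2 * N) => [|y]; first exact: mulr_ge0.
pose fix rest n : Y := if n is n'.+1 then rest n' - T (phi (rest n')) else y.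
pose sol n := \sum_(i < n) phi (rest i).
have restE n : T (sol n) = y - rest n.
  elim: n => [|n IH]; first by rewrite /sol big_ord0 (raddf0 T) subrr.
  by rewrite /sol big_ord_recr raddfD /= -/(sol n) IH opprB addrCA addrC.
have rest_le n : rnorm (rest n) <= rnorm y / 2 ^+ n.
  elim: n => [|n IH]; first by rewrite expr0 divr1.
  apply: le_trans (phiH _) _.
  by rewrite exprSr invfM mulrA ler_pM2r ?invr_gt0.
have step n : rnorm (sol n.+1 - sol n) <= N * rnorm y / 2 ^+ n.
  rewrite /sol big_ord_recr/= addrAC subrr add0r; apply: le_trans (phiN _) _.
  by rewrite -mulrA ler_wpM2l.
have [x sx] := cX step; exists x.
  apply: (fast_cvg_uniq _ (fast_cvg_op T sx)).
  by exists (rnorm y) => n; rewrite restE addrAC subrr sub0r rnormN.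
have := fast_cvg_rdist step sx 0%N.
by rewrite /sol big_ord0 sub0r rnormN expr0 divr1 mulrA.
Qed.

End Surjective.
End OpenMapping.

(** * Operators whose range has finite codimension *)

Section CofiniteRange.
Context {R : realType}.
Implicit Types X Y : normedModType R[i].

Section Linearity.
Context {X Y : normedModType R[i]} (T : bounded_op X Y).

Lemma bounded_op0 : T 0 = 0. Proof. exact: raddf0. Qed.

Lemma bounded_opB x y : T (x - y) = T x - T y. Proof. exact: linearB. Qed.

Lemma bounded_opD x y : T (x + y) = T x + T y. Proof. exact: linearD. Qed.

Lemma bounded_opN x : T (- x) = - T x. Proof. exact: linearN. Qed.

Lemma bounded_opZ a x : T (a *: x) = a *: T x. Proof. exact: linearZZ. Qed.

Lemma bounded_op_sum n (c : 'I_n -> R[i]) (f : 'I_n -> X) :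
  T (\sum_(i < n) c i *: f i) = \sum_(i < n) c i *: T (f i).
Proof. by rewrite linear_sum; apply: eq_bigr => i _; rewrite linearZZ. Qed.

End Linearity.

Lemma range_subspace X Y (T : bounded_op X Y) : lin_subspace (range T).
Proof.
split=> [|a _ _ [x _ <-] [y _ <-]]; first by exists 0; rewrite // bounded_op0.
by exists (a *: x + y); rewrite ?bounded_op_linear.
Qed.

Lemma ker_subspace Y (T : bounded_op Y Y) : lin_subspace (ker_op T).
Proof.
split=> [|a x y]; rewrite /ker_op /= ?bounded_op0// => Tx Ty.
by rewrite bounded_op_linear Tx Ty scaler0 addr0.
Qed.

Section AddVector.
Context {X Y : normedModType R[i]} (T : bounded_op X Y) (e : Y).

Lemma add_vector_bounded :
  (fun z : X * R[i]^o => T z.1 + z.2 *: e) \in @bounded_linear R _ Y.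
Proof.
apply: (@bounded_linear_rnorm _ _ _ _ (opnorm T + rnorm e)) => [a x y|z] /=.
  by rewrite bounded_op_linear scalerDr scalerDl addrACA scalerA.
apply: (le_trans (rnormD _ _)); rewrite mulrDl rnormZ; apply: lerD.
  apply: (le_trans (rnorm_bounded_op _ _)).
  by apply: ler_wpM2l; [exact: opnorm_ge0|exact: rnorm_fst].
rewrite mulrC; apply: ler_wpM2l; [exact: rnorm_ge0|exact: (rnorm_snd z)].
Qed.

Definition add_vector : bounded_op (X * R[i]^o)%type Y :=
  BoundedOp add_vector_bounded.

End AddVector.

(** Each vector [e i] is absorbed into the operator by replacing [X] with [X * R[i]^o], until a
    surjective operator remains. *)
Lemma open_mapping_mod X Y (T : bounded_op X Y) n (e : 'I_n -> Y) :
  fast_complete X -> fast_complete Y ->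
  (forall y, exists x c, y = T x + \sum_(i < n) c i *: e i) ->
  exists2 K : R, 0 <= K & forall y, exists x (c : 'I_n -> R[i]),
    [/\ y = T x + \sum_(i < n) c i *: e i, rnorm x <= K * rnorm y
      & forall i, rnorm (c i) <= K * rnorm y].
Proof.
move=> + cY; elim: n X T e => [|n IH] X T e cX T_onto.
  have [|K K0 KP] := open_mapping (T := T) cX cY.
    by move=> y; have [x [c ->]] := T_onto y; exists x; rewrite big_ord0 addr0.
  exists K => // y; have [x yx xK] := KP y; exists x, (fun=> 0); split=> //.
    by rewrite big_ord0 addr0.
  by case.
have [||K K0 KP] := IH _ (add_vector T (e ord0)) (fun i => e (lift ord0 i)).
- exact: (prod_fast_complete cX complex_fast_complete).
- move=> y; have [x [c ->]] := T_onto y.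
  exists (x, c ord0), (fun i => c (lift ord0 i)).
  by rewrite big_ord_recl addrA.
exists K => // y; have [z [c [yz zK cK]]] := KP y.
exists z.1, (fun i => if unlift ord0 i is Some j then c j else z.2); split.
- rewrite big_ord_recl unlift_none addrA {1}yz; congr (_ + _).
  by apply: eq_bigr => i _; rewrite liftK.
- exact: le_trans (rnorm_fst z) zK.
- move=> i; case: unliftP => [j _|_]; first exact: cK.
  exact: le_trans (rnorm_snd z) zK.
Qed.

(** The coordinates along [e] are unique because [e] is free modulo the range. Hence the bounded
    choice made by [open_mapping_mod] is automatically linear, and gives continuous functionals. *)
Lemma cofinite_range_coordinates X Y (T : bounded_op X Y) n :
  fast_complete X -> fast_complete Y -> quotient_dim setT (range T) n ->
  exists (e : 'I_n -> Y) (kappa : 'I_n -> dual Y) (K : R),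
    [/\ 0 <= K, forall i x, kappa i (T x) = 0,
      forall i j, kappa i (e j) = (i == j)%:R
    & forall y, exists2 x, y = T x + \sum_(i < n) (kappa i y : R[i]) *: e i
                         & rnorm x <= K * rnorm y].
Proof.
move=> cX cY [e [_ fe se]].
have uniq x x' c c' : T x + \sum_(i < n) c i *: e i =
    T x' + \sum_(i < n) c' i *: e i -> forall i, c i = c' i.
  move=> xx' i; apply/eqP; rewrite -subr_eq0; apply/eqP; move: i.
  apply: (fe (fun i => c i - c' i)); exists (x' - x) => //.
  under eq_bigr do rewrite scalerBl.
  rewrite sumrB bounded_opB; apply/eqP; rewrite subr_eq addrAC eq_sym subr_eq.
  by rewrite [eqbLHS]addrC xx' addrC.
have [|K K0 KP] := @open_mapping_mod _ _ T n e cX cY.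
  move=> y; have [c [x _ yx]] := se y I; exists x, c.
  by rewrite yx subrK.
have /choice[k kP] y : exists c : 'I_n -> R[i], exists x,
    [/\ y = T x + \sum_(i < n) c i *: e i, rnorm x <= K * rnorm y
      & forall i, rnorm (c i) <= K * rnorm y].
  by have [x [c]] := KP y; exists c, x.
have kE x c y : y = T x + \sum_(i < n) c i *: e i -> forall i, k y i = c i.
  by move=> yE; have [x' [yx' _ _]] := kP y; apply: (uniq x' x); rewrite -yx'.
have kb i : (fun y => k y i) \in @bounded_linear R Y R[i]^o.
  apply: (@bounded_linear_rnorm _ _ _ _ K) => [a y y'|y]; last first.
    by have [x [_ _ +]] := kP y; apply.
  have [x [yx _ _]] := kP y; have [x' [yx' _ _]] := kP y'.
  apply: (kE (a *: x + x') (fun i => a * k y i + k y' i)).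
  rewrite {1}yx {1}yx' bounded_op_linear scalerDr addrACA; congr (_ + _).
  rewrite scaler_sumr -big_split; apply: eq_bigr => j _.
  by rewrite scalerDl scalerA.
exists e, (fun i => BoundedOp (kb i)), K; split=> // [i x|i j|y] /=.
- apply: (kE x (fun=> 0)); rewrite big1 ?addr0// => j _.
  by rewrite scale0r.
- apply: (kE 0 (fun i => (i == j)%:R)); rewrite bounded_op0 add0r (bigD1 j)//=.
  rewrite eqxx scale1r big1 ?addr0// => l /negPf ->; exact: scale0r.
- by have [x [yx xK _]] := kP y; exists x.
Qed.

(** An element on which all coordinate functionals vanish is in the range, and these functionals are
    killed by the adjoint. *)
Lemma cofinite_range_sep X Y (T : bounded_op X Y) n y :
  fast_complete X -> fast_complete Y -> quotient_dim setT (range T) n ->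
  ~ range T y -> exists2 h : dual Y, adjoint T h = 0 & h y <> 0.
Proof.
move=> cX cY /cofinite_range_coordinates[//|//|e [k [K [K0 kT _ kP]]]] Ty.
apply: contrapT => nh; apply: Ty.
have [x yx _] := kP y; exists x => //.
rewrite [RHS]yx big1 ?addr0// => i _.
suff -> : k i y = 0 by rewrite scale0r.
apply: contrapT => kiy; apply: nh; exists (k i) => //.
by apply: bounded_opP => z; exact: kT.
Qed.

(** The preimage of [g] is [g \o s], for a bounded section [s] of [T] modulo the complement. Such an
    [s] is linear only up to the kernel of [T], which [g] does not see. *)
Lemma cofinite_range_factor X Y (T : bounded_op X Y) n (g : dual X) :
  fast_complete X -> fast_complete Y -> quotient_dim setT (range T) n ->
  (forall x, T x = 0 -> g x = 0) -> range (adjoint T) g.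
Proof.
move=> cX cY /cofinite_range_coordinates[//|//|e [k [K [K0 kT ke kP]]]] gT.
have /choice[s sP] y : exists x, y = T x + \sum_(i < n) (k i y : R[i]) *: e i /\
    rnorm x <= K * rnorm y by have [x] := kP y; exists x.
have Ts y : T (s y) = y - \sum_(i < n) (k i y : R[i]) *: e i.
  by rewrite {2}(sP y).1 addrK.
have hb : g \o s \in @bounded_linear R Y R[i]^o.
  apply: (@bounded_linear_rnorm _ _ _ _ (opnorm g * K)) => [a y y'|y] /=.
    apply/eqP; rewrite -bounded_op_linear -subr_eq0 -bounded_opB; apply/eqP/gT.
    rewrite bounded_opB bounded_op_linear !Ts scalerBr addrACA -opprD.
    rewrite scaler_sumr -big_split/=; apply/eqP; rewrite subr_eq0; apply/eqP.
    congr (_ - _); apply: eq_bigr => i _.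
    by rewrite bounded_op_linear scalerDl scalerA.
  apply: (le_trans (rnorm_bounded_op _ _)); rewrite -mulrA.
  by apply: ler_wpM2l; [exact: opnorm_ge0|exact: (sP y).2].
exists (BoundedOp hb) => //; apply: bounded_opP => x /=.
apply/eqP; rewrite -subr_eq0 -bounded_opB; apply/eqP/gT.
rewrite bounded_opB Ts big1 ?subr0 ?subrr// => i _.
by rewrite kT scale0r.
Qed.

Lemma cofinite_range_closed X Y (T : bounded_op X Y) n :
  fast_complete X -> fast_complete Y -> quotient_dim setT (range T) n ->
  closed (range T).
Proof.
move=> cX cY /cofinite_range_coordinates[//|//|e [k [K [K0 kT _ kP]]]] y Cy.
have [x yx _] := kP y; exists x => //.
rewrite [RHS]yx big1 ?addr0// => i _.
suff -> : k i y = 0 by rewrite scale0r.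
apply: (@rnorm_le0 _ R[i]); rewrite leNgt; apply/negP => ky.
have o0 := opnorm_ge0 (k i).
(* As [k i] vanishes on the range, no point of the range is closer than [d] to [y]; the [+ 1] covers
   a zero operator norm. *)
pose d := rnorm (k i y) / (opnorm (k i) + 1).
have d0 : 0 < d by rewrite divr_gt0// ltr_wpDl.
have [|_ [[z _ <-]]] := Cy (ball y d%:C).
  by apply: nbhsx_ballx; rewrite ltcR.
rewrite -ball_normE /= -rnormE ltcR ltNge => /negP; apply.
rewrite /d ler_pdivrMr ?ltr_wpDl//.
rewrite -[k i y]subr0 -(kT i z) -bounded_opB (le_trans (rnorm_bounded_op _ _))//.
by rewrite mulrC ler_wpM2l ?rnorm_ge0// lerDl.
Qed.

End CofiniteRange.

(** * Hahn-Banach theorem *)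

Section HahnBanach.
Context {R : realType} {X : normedModType R[i]}.
Implicit Types (p q : X -> R) (x y : X).

Definition sublinear p :=
  (forall x y, p (x + y) <= p x + p y) /\
  (forall (t : R) x, 0 < t -> p (t%:C *: x) <= t * p x).

Lemma real_neq0 (t : R) : 0 < t -> t%:C != 0 :> R[i].
Proof. by move=> t0; rewrite gt_eqF// ltcR. Qed.

Lemma sublinearZ p (t : R) x :
  sublinear p -> 0 < t -> p (t%:C *: x) = t * p x.
Proof.
move=> [_ pZ] t0; apply/eqP; rewrite eq_le pZ//= -ler_pdivlMl//.
have := pZ t^-1 (t%:C *: x); rewrite invr_gt0 => /(_ t0).
by rewrite fmorphV/= scalerK// real_neq0.
Qed.

Lemma sublinear0 p : sublinear p -> p 0 = 0.
Proof.
by move=> sp; have := sublinearZ 0 sp (ltr0n R 2); rewrite scaler0; lra.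
Qed.

Lemma sublinearN_le p x : sublinear p -> - p (- x) <= p x.
Proof. by move=> sp; have := sp.1 x (- x); rewrite subrr sublinear0//; lra. Qed.

Lemma sublinear_rnorm : sublinear (@rnorm R X).
Proof.
by split=> [x y|t x t0]; rewrite ?rnormD// rnormZ rnormC// ltW.
Qed.

(** The term [t = 0] gives [tilt p y x <= p x]; the term [t = 1] gives
    [tilt p y x <= p (x + y) - p y]. So a [p] that is below all its tilts is superadditive. *)
Definition tilt p y x : R :=
  inf [set p (x + t%:C *: y) - t * p y | t in [set t : R | 0 <= t]].

Section Tilt.
Variables (p : X -> R) (y : X).
Hypothesis sp : sublinear p.

Let lb x (t : R) : 0 <= t -> - p (- x) <= p (x + t%:C *: y) - t * p y.
Proof.
rewrite le_eqVlt => /predU1P[<-|t0].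
  by rewrite scale0r addr0 mul0r subr0; exact: sublinearN_le.
rewrite -(sublinearZ y sp t0).
by have := sp.1 (x + t%:C *: y) (- x); rewrite addrAC subrr add0r; lra.
Qed.

Lemma tilt_le x (t : R) : 0 <= t -> tilt p y x <= p (x + t%:C *: y) - t * p y.
Proof.
move=> t0; apply: ge_inf; last by exists t.
by exists (- p (- x)) => _ [s s0 <-]; exact: lb.
Qed.

Lemma le_tilt x (a : R) :
  (forall t : R, 0 <= t -> a <= p (x + t%:C *: y) - t * p y) -> a <= tilt p y x.
Proof.
move=> H; apply: lb_le_inf; first by eexists; exists 0; rewrite /= ?lexx.
by move=> _ [t t0 <-]; exact: H.
Qed.

Lemma tilt_le_id x : tilt p y x <= p x.
Proof. by have := @tilt_le x 0 (lexx 0); rewrite scale0r addr0; lra. Qed.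

Lemma sublinear_tilt : sublinear (tilt p y).
Proof.
split=> [x x'|c x c0].
  rewrite -lerBlDr; apply: le_tilt => t t0.
  rewrite lerBlDr [leRHS]addrC -lerBlDr; apply: le_tilt => s s0.
  rewrite lerBlDr; apply: le_trans (@tilt_le _ (s + t) _) _; first exact: addr_ge0.
  rewrite rmorphD/= scalerDl.
  have := sp.1 (x + t%:C *: y) (x' + s%:C *: y).
  by rewrite addrACA (addrC (t%:C *: y)); lra.
rewrite -ler_pdivrMl//; apply: le_tilt => t t0.
rewrite ler_pdivrMl//; apply: le_trans (@tilt_le _ (c * t) _) _.
  by rewrite mulr_ge0// ltW.
by rewrite rmorphM/= -scalerA -scalerDr sublinearZ//; lra.
Qed.

End Tilt.

(* A pointwise minimal sublinear functional is additive: it coincides with all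
   its tilts. *)
Lemma minimal_sublinear p0 : sublinear p0 ->
  exists f, [/\ sublinear f, forall x, f x <= p0 x
    & forall q, sublinear q -> (forall x, q x <= f x) -> forall x, f x <= q x].
Proof.
move=> sp0.
pose T := {p | sublinear p /\ forall x, p x <= p0 x}.
(* The pointwise order is reversed, so that the maximal element given by Zorn's lemma is a minimal
   functional; chains are bounded by their pointwise infimum. *)
pose below (s t : T) := `[< forall x, sval t x <= sval s x >].
pose t0 : T := exist _ p0 (conj sp0 (fun x => lexx (p0 x))).
have [||A totA|[f [sf fp0]] fmin] := @ZL_preorder T t0 below.
- by move=> t; apply/asboolP.
- by move=> r s t /asboolP rs /asboolP st; apply/asboolP => x; exact: le_trans (rs x).
- have [[a Aa]|A0] := pselect (exists a, A a); last first.
    by exists t0 => s As; exfalso; apply: A0; exists s.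
  pose m x := inf [set sval s x | s in A].
  have m_le s x : A s -> m x <= sval s x.
    move=> As; apply: ge_inf; last by exists s.
    exists (- p0 (- x)) => _ [[q [sq qp0]] Aq <-] /=.
    by apply: le_trans (sublinearN_le _ sq); rewrite lerN2.
  have le_m x (b : R) : (forall s, A s -> b <= sval s x) -> b <= m x.
    move=> H; apply: lb_le_inf; first by exists (sval a x), a.
    by move=> _ [s As <-]; exact: H.
  have sm : sublinear m.
    split=> [x y|t x t0'].
      rewrite -lerBlDr; apply/le_m => s As.
      rewrite lerBlDr [leRHS]addrC -lerBlDr; apply/le_m => s' As'; rewrite lerBlDr.
      (* Of two members of the chain, the smaller one serves both arguments. *)
      have [/asboolP ss'|/asboolP ss'] := totA _ _ As As'.
        apply: le_trans (m_le _ _ As') _; apply: le_trans ((svalP s').1.1 _ _) _.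
        by rewrite addrC lerD2l.
      apply: le_trans (m_le _ _ As) _; apply: le_trans ((svalP s).1.1 _ _) _.
      by rewrite addrC lerD2r.
    rewrite -ler_pdivrMl//; apply/le_m => s As.
    rewrite ler_pdivrMl//; apply: le_trans (m_le _ _ As) _.
    exact: (svalP s).1.2.
  have mp0 x : m x <= p0 x by apply: le_trans (m_le _ _ Aa) _; exact: (svalP a).2.
  exists (exist _ m (conj sm mp0)) => s As; apply/asboolP => x /=.
  exact: m_le.
- exists f; split=> // q sq qf.
  have qp0 x : q x <= p0 x := le_trans (qf x) (fp0 x).
  by have /asboolP := fmin (exist _ q (conj sq qp0)) (asboolT qf).
Qed.

(** A minimal functional below the norm tilted by [x0]: at [- x0] this tilt is at most
    [rnorm 0 - rnorm x0], which forces the lower bound at [x0]. *)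
Lemma real_norming_functional x0 : exists f : X -> R,
  [/\ forall x y, f (x + y) = f x + f y,
    forall (t : R) x, f (t%:C *: x) = t * f x,
    forall x, f x <= rnorm x & rnorm x0 <= f x0].
Proof.
have sn := sublinear_rnorm.
have [f [sf fn fmin]] := minimal_sublinear (sublinear_tilt x0 sn).
have fB x y : f x + f y <= f (x + y).
  have := fmin _ (sublinear_tilt y sf) (tilt_le_id y sf) x.
  move/le_trans => /(_ _ (tilt_le y sf x ler01)).
  by rewrite scale1r mul1r; lra.
have fD x y : f (x + y) = f x + f y.
  by apply/eqP; rewrite eq_le fB sf.1.
have fN x : f (- x) = - f x.
  by have := fD x (- x); rewrite subrr sublinear0//; lra.
exists f; split=> // [t x|x|].
- have [t0|t0|->] := ltrgtP t 0.
  + rewrite -[t]opprK rmorphN/= scaleNr fN sublinearZ ?oppr_gt0//; lra.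
  + exact: sublinearZ.
  + by rewrite scale0r sublinear0// mul0r.
- exact: le_trans (fn x) (tilt_le_id _ sn _).
- rewrite -[f x0]opprK -fN lerNr; apply: le_trans (fn _) _.
  apply: le_trans (tilt_le x0 sn (- x0) ler01) _.
  by rewrite scale1r addNr rnorm0; lra.
Qed.

Lemma dual_separates x0 : x0 != 0 -> exists g : dual X, g x0 != 0.
Proof.
move=> x00; have [f [fD fZ fn fx0]] := real_norming_functional x0.
(* The usual complexification [f x - i f (i x)] of a real functional, which makes it complex
   linear. *)
pose g x : R[i]^o := (f x +i* - f ('i%C *: x))%C.
have fabs x : `|f x| <= rnorm x.
  rewrite ler_norml fn andbT lerNl.
  have := fn (- x); rewrite rnormN -scaleN1r.
  by rewrite (_ : -1 = (-1 : R)%:C) ?fZ ?rmorphN1//; lra.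
have lg : linear g.
  move=> a x y; set b := complex.Re a; set c := complex.Im a.
  have ax : a *: x = b%:C *: x + c%:C *: ('i%C *: x).
    by rewrite [in LHS](complexE a) scalerDl mulrC scalerA.
  have iax : 'i%C *: (a *: x) = b%:C *: ('i%C *: x) + (- c)%:C *: x.
    rewrite ax scalerDr !scalerA ['i%C * b%:C]mulrC mulrAC.
    by rewrite -expr2 sqr_i mulN1r rmorphN.
  have aE : a = (b +i* c)%C by rewrite /b /c; case: (a).
  rewrite /g scalerDr iax ax !fD !fZ [in RHS]aE.
  by rewrite /GRing.scale/=; simpc; congr (_ +i* _)%C; ring.
have bg : g \in @bounded_linear R X R[i]^o.
  apply: (@bounded_linear_rnorm _ _ _ _ 2) => // x.
  apply: (le_trans (rnorm_complex_le _)); rewrite /= normrN.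
  have := fabs x; have := fabs ('i%C *: x); rewrite rnormZ.
  have -> : rnorm ('i%C : R[i]) = 1.
    by rewrite rnorm_complex/= expr0n/= add0r expr1n sqrtr1.
  by lra.
exists (BoundedOp bg); apply/eqP => /(congr1 (@complex.Re R))/= fx00.
by move: fx0; rewrite fx00; apply/negP; rewrite -ltNge rnorm_gt0.
Qed.

Lemma dual_sumE n (c : 'I_n -> R[i]) (g : 'I_n -> dual X) x :
  (\sum_(i < n) c i *: g i) x = \sum_(i < n) c i * g i x.
Proof.
elim: n c g => [|n IH] c g; first by rewrite !big_ord0.
by rewrite [in LHS]big_ord_recr [in RHS]big_ord_recr/= -IH.
Qed.

(** Removing from [w] its projection along [psi] leaves a nonzero [v]. A functional equal to 1 at
    [v], corrected by the [psi i] to vanish on the [y i], still takes the value 1 at [w]. *)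
Lemma dual_avoids n (y : 'I_n -> X) (psi : 'I_n -> dual X) (w : X) :
  (forall i j, psi i (y j) = (i == j)%:R) ->
  (forall c : 'I_n -> R[i], w <> \sum_(i < n) c i *: y i) ->
  exists phi : dual X, (forall i, phi (y i) = 0) /\ phi w = 1.
Proof.
move=> psiP wy; pose v := w - \sum_(i < n) (psi i w : R[i]) *: y i.
have v0 : v != 0 by rewrite subr_eq0; apply/eqP/wy.
have [h hv] := dual_separates v0.
pose h1 : dual X := (h v)^-1 *: h.
have h1v : h1 v = 1 by rewrite bounded_opZE; exact: mulVf.
exists (h1 - \sum_(i < n) (h1 (y i) : R[i]) *: psi i); split=> [j|].
  rewrite bounded_opBE dual_sumE (bigD1 j)//= psiP eqxx mulr1 big1 ?addr0 ?subrr//.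
  by move=> i /negPf ij; rewrite psiP ij mulr0.
rewrite bounded_opBE dual_sumE -[RHS]h1v /v bounded_opB bounded_op_sum.
by congr (_ - _); apply: eq_bigr => i _; rewrite mulrC.
Qed.

(** Induction: [dual_avoids] yields the functional of the first vector, and a multiple of it
    corrects the functionals of the others. *)
Lemma dual_basis n (y : 'I_n -> X) : free_mod [set 0] y ->
  exists psi : 'I_n -> dual X, forall i j, psi i (y j) = (i == j)%:R.
Proof.
elim: n y => [|n IH] y fy; first by exists (fun=> 0) => -[].
pose y' i := y (lift ord0 i).
have fy' (c : 'I_n -> R[i]) b :
    b *: y ord0 + \sum_(i < n) c i *: y' i = 0 -> b = 0 /\ forall i, c i = 0.
  move=> cy; pose d i := if unlift ord0 i is Some j then c j else b.
  have /fy d0 : [set 0] (\sum_(i < n.+1) d i *: y i).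
    rewrite /= -[RHS]cy big_ord_recl /d unlift_none; congr (_ + _).
    by apply: eq_bigr => i _; rewrite liftK.
  split=> [|i]; first by have := d0 ord0; rewrite /d unlift_none.
  by have := d0 (lift ord0 i); rewrite /d liftK.
have [|psi psiP] := IH y'.
  move=> c /= cy; suff [] : 0 = 0 :> R[i] /\ forall i, c i = 0 by [].
  by apply: fy'; rewrite scale0r add0r.
have [|phi [phi1 phi0]] := @dual_avoids _ y' psi (y ord0) psiP.
  move=> c y0; have [|/eqP] := fy' (fun i => - c i) 1; last by rewrite oner_eq0.
  rewrite scale1r y0 -big_split big1// => i _ /=.
  by rewrite -scalerDl subrr scale0r.
exists (fun i => if unlift ord0 i is Some j
                 then psi j - (psi j (y ord0) : R[i]) *: phi else phi) => i j.
case: (unliftP ord0 i) => [i' ->|->]; case: (unliftP ord0 j) => [j' ->|->].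
- rewrite bounded_opBE bounded_opZE -/(y' j') phi1 psiP scaler0 subr0.
  by rewrite (inj_eq lift_inj).
- rewrite bounded_opBE bounded_opZE phi0 [_ *: 1]mulr1 subrr.
  by rewrite eq_sym (negPf (neq_lift _ _)).
- by rewrite -/(y' j') phi1 (negPf (neq_lift _ _)).
- by rewrite phi0 eqxx.
Qed.

End HahnBanach.

(** * Power series and analyticity *)

Section QuadraticDifferentiability.
Context {R : realType}.
Implicit Types V W : normedModType R[i].

(* Differentiability with a quadratic remainder: it holds for analytic
   functions, is stable under the operations needed, and implies [derivable]. *)
Definition qdiff V (f : R[i] -> V) (z : R[i]) :=
  exists (d : V) (C delta : R), 0 < delta /\ forall h : R[i], rnorm h <= delta ->
    rnorm (f (z + h) - f z - h *: d) <= C * rnorm h ^+ 2.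

Lemma qdiff_lipschitz V (f : R[i] -> V) z : qdiff f z ->
  exists (d : V) (C delta : R), [/\ 0 <= C, 0 < delta & forall h : R[i],
    rnorm h <= delta ->
    rnorm (f (z + h) - f z - h *: d) <= C * rnorm h ^+ 2 /\
    rnorm (f (z + h) - f z) <= C * rnorm h].
Proof.
move=> [d [C [delta [d0 H]]]].
exists d, (`|C| + rnorm d), (Num.min delta 1); split.
- by rewrite addr_ge0 ?rnorm_ge0.
- by rewrite lt_min d0 ltr01.
move=> h; rewrite le_min => /andP[/H hC h1].
have h0 := rnorm_ge0 h; have dn := rnorm_ge0 d; have hh := sqr_ge0 (rnorm h).
have hh' : rnorm h ^+ 2 <= rnorm h by rewrite expr2 ler_piMl.
have CC : C * rnorm h ^+ 2 <= `|C| * rnorm h ^+ 2 by rewrite ler_wpM2r// ler_norm.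
split.
  apply: le_trans hC (le_trans CC _).
  by rewrite ler_wpM2r// lerDl.
have := rdistD (h *: d) (f (z + h) - f z) 0; rewrite !subr0 rnormZ.
have := ler_wpM2l (normr_ge0 C) hh'.
by rewrite mulrDl mulrC [_ * rnorm d]mulrC; lra.
Qed.

Lemma qdiff_cst V (v : V) z : qdiff (fun=> v) z.
Proof.
exists 0, 0, 1; split=> // h _.
by rewrite scaler0 subr0 subrr rnorm0 mul0r.
Qed.

Lemma qdiffD V (f g : R[i] -> V) z :
  qdiff f z -> qdiff g z -> qdiff (fun w => f w + g w) z.
Proof.
move=> [d [C [e [e0 H]]]] [d' [C' [e' [e0' H']]]].
exists (d + d'), (C + C'), (Num.min e e'); rewrite lt_min e0 e0'; split=> // h.
rewrite le_min => /andP[/H hC /H' hC'].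
rewrite [- (f z + g z)]opprD (addrACA (f (z + h))) scalerDr.
rewrite [- (h *: d + _)]opprD (addrACA (f (z + h) - f z)) mulrDl.
by rewrite (le_trans (rnormD _ _))// lerD.
Qed.

Lemma qdiff_sum V n (f : 'I_n -> R[i] -> V) z :
  (forall i, qdiff (f i) z) -> qdiff (fun w => \sum_(i < n) f i w) z.
Proof.
elim: n f => [|n IH] f Hf.
  by under eq_fun do rewrite big_ord0; exact: qdiff_cst.
under eq_fun do rewrite big_ord_recr.
by apply: qdiffD => [|//]; apply: IH => i; exact: Hf.
Qed.

Lemma qdiffZ V (a : R[i] -> R[i]^o) (f : R[i] -> V) z :
  qdiff a z -> qdiff f z -> qdiff (fun w => (a w : R[i]) *: f w) z.
Proof.
move=> /qdiff_lipschitz[d [C [e [C0 e0 H]]]]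
  /qdiff_lipschitz[d' [C' [e' [C0' e0' H']]]].
exists ((a z : R[i]) *: d' + (d : R[i]) *: f z),
  (rnorm (a z) * C' + C * rnorm (f z) + C * C'), (Num.min e e').
rewrite lt_min e0 e0'; split=> // h.
rewrite le_min => /andP[/H[hC hL] /H'[hC' hL']].
(* The Leibniz remainder splits into the two remainders of the factors and a product of two
   increments, each at most linear in [h]. *)
have -> : (a (z + h) : R[i]) *: f (z + h) - (a z : R[i]) *: f z -
      h *: ((a z : R[i]) *: d' + (d : R[i]) *: f z) =
    (a z : R[i]) *: (f (z + h) - f z - h *: d') +
    (a (z + h) - a z - h *: d : R[i]) *: f z +
    (a (z + h) - a z : R[i]) *: (f (z + h) - f z).
  move: (a (z + h) : R[i]) (a z : R[i]) (f (z + h)) (f z) => A B F G.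
  have -> : A *: F - B *: G = B *: (F - G) + (A - B) *: G + (A - B) *: (F - G).
    rewrite addrAC -addrA (scalerBr (A - B)) subrK scalerBr scalerBl.
    by rewrite addrC addrA subrK.
  rewrite (scalerDr h) opprD [in LHS]addrAC addrACA; congr (_ + _ + _).
    by rewrite [in RHS]scalerBr !scalerA mulrC.
  by rewrite [in RHS]scalerBl scalerA.
apply: (le_trans (rnormD _ _)); apply: (le_trans (lerD (rnormD _ _) (lexx _))).
rewrite !rnormZ !mulrDl; apply: lerD; [apply: lerD|].
- by rewrite -mulrA ler_wpM2l ?rnorm_ge0.
- by rewrite mulrAC ler_wpM2r ?rnorm_ge0.
- by rewrite expr2 mulrACA; apply: ler_pM => //; exact: rnorm_ge0.
Qed.

Lemma qdiff_op V W (T : bounded_op V W) (f : R[i] -> V) z :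
  qdiff f z -> qdiff (fun w => T (f w)) z.
Proof.
move=> [d [C [e [e0 H]]]]; exists (T d), (opnorm T * C), e; split=> // h /H hC.
rewrite -linearZZ -!bounded_opB (le_trans (rnorm_bounded_op _ _))// -mulrA.
by rewrite ler_wpM2l// opnorm_ge0.
Qed.

Lemma qdiff_shift V (f : R[i] -> V) (a z : R[i]) :
  qdiff f (z - a) -> qdiff (fun w => f (w - a)) z.
Proof.
move=> [d [C [e [e0 H]]]]; exists d, C, e; split=> // h.
by rewrite (addrAC z h); exact: H.
Qed.

Lemma qdiff_neq0 V (f : R[i] -> V) z : qdiff f z -> f z != 0 ->
  exists2 e : R, 0 < e & forall h, rnorm h < e -> f (z + h) != 0.
Proof.
move=> /qdiff_lipschitz[d [C [e [C0 e0 H]]]] fz.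
have n0 := rnorm_gt0 fz.
exists (Num.min e (rnorm (f z) / (C + 1))).
  by rewrite lt_min e0 divr_gt0// ltr_wpDl.
move=> h; rewrite lt_min => /andP[/ltW/H[_ +]].
rewrite ltr_pdivlMr ?ltr_wpDl// => hL hn.
apply/eqP => fzh; move: hL; rewrite fzh sub0r rnormN.
by have := rnorm_ge0 h; move: hn; rewrite mulrDr mulr1 mulrC; lra.
Qed.

Lemma qdiff_prod n (f : 'I_n -> R[i] -> R[i]^o) z :
  (forall i, qdiff (f i) z) ->
  qdiff (fun w => (\prod_(i < n) (f i w : R[i]) : R[i]^o)) z.
Proof.
elim: n f => [|n IH] f Hf.
  by under eq_fun do rewrite big_ord0; exact: (@qdiff_cst R[i]^o 1).
under eq_fun do rewrite big_ord_recl.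
by apply: (@qdiffZ R[i]^o) => [//|]; apply: IH => i; exact: Hf.
Qed.

Lemma qdiff_det n (D : R[i] -> 'M[R[i]]_n) z :
  (forall i j, qdiff (fun w => (D w i j : R[i]^o)) z) ->
  qdiff (fun w => (\det (D w) : R[i]^o)) z.
Proof.
move=> HD; rewrite /determinant.
elim: (index_enum _) => [|s r IH].
  by under eq_fun do rewrite big_nil; exact: (@qdiff_cst R[i]^o 0).
under eq_fun do rewrite big_cons.
apply: (@qdiffD R[i]^o) => //.
apply: (@qdiffZ R[i]^o); first exact: (@qdiff_cst R[i]^o).
apply: qdiff_prod => i; exact: HD.
Qed.

Lemma qdiff_adj n (D : R[i] -> 'M[R[i]]_n) z i j :
  (forall i j, qdiff (fun w => (D w i j : R[i]^o)) z) ->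
  qdiff (fun w => ((\adj (D w)) i j : R[i]^o)) z.
Proof.
move=> HD; under eq_fun do rewrite mxE /cofactor.
apply: (@qdiffZ R[i]^o); first exact: (@qdiff_cst R[i]^o).
apply: qdiff_det => k l.
by under eq_fun do rewrite !mxE; exact: HD.
Qed.

Lemma qdiff_derivable V (f : R[i]^o -> V) (z : R[i]^o) :
  qdiff f z -> derivable f z 1.
Proof.
move=> /qdiff_lipschitz[d [C [e [C0 e0 H]]]]; apply/cvg_ex; exists d.
apply/cvgrPdist_le => /= a a0.
have a0' : 0 < complex.Re a by rewrite -ltcR RRe_real// gtr0_real.
pose b := Num.min e (complex.Re a / (C + 1)).
have b0 : 0 < b by rewrite lt_min e0 divr_gt0// ltr_wpDl.
exists b%:C => /=; first by rewrite ltcR.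
move=> h; rewrite /= /ball_/= sub0r normrN -rnormE ltcR => hb h0.
have -> : a = (complex.Re a)%:C by rewrite RRe_real// gtr0_real.
rewrite -rnormE lecR.
move: hb; rewrite lt_min => /andP[/ltW/H[hC _]].
rewrite ltr_pdivlMr ?ltr_wpDl// => /ltW ha.
have hn : 0 < rnorm h := rnorm_gt0 h0.
rewrite -(ler_pM2l hn) -rnormZ scalerBr scalerA divff// scale1r rdistC.
rewrite [_%:A]mulr1 (addrC h).
apply: le_trans hC _; rewrite expr2 mulrCA ler_pM2l//.
by move: ha; rewrite mulrDr mulr1 mulrC; lra.
Qed.

End QuadraticDifferentiability.

(** * Power series with coefficients in a normed space *)

Section PowerSeries.
Context {R : realType} {V : normedModType R[i]}.

Lemma fast_cvg_rnorm_le (v : nat -> V) l (B : R) :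
  fast_cvg v l -> (forall n, rnorm (v n) <= B) -> rnorm l <= B.
Proof.
move=> [K vK] vB; rewrite -subr_le0; apply: (@geometric_le0 _ _ K) => n.
have := rdistD (v n) l 0; rewrite !subr0 rdistC.
by have := vK n; have := vB n; lra.
Qed.

Definition power_sum (u : nat -> V) (z : R[i]) n : V := \sum_(m < n) z ^+ m *: u m.

(** The derivative [m * z ^ (m - 1)] of [z ^ m], by the product rule, so that inductions on [m] need
    no predecessor. *)
Fixpoint dpow (z : R[i]) m : R[i] :=
  if m is m'.+1 then z * dpow z m' + z ^+ m' else 0.

Lemma dpow_le (z : R[i]) (r : R) m :
  rnorm z <= r -> r * rnorm (dpow z m) <= (2 * r) ^+ m.
Proof.
move=> zr; have r0 := le_trans (rnorm_ge0 z) zr.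
elim: m => [|m IH] /=; first by rewrite rnorm0 mulr0 expr0.
have zm : rnorm z ^+ m <= (2 * r) ^+ m.
  by apply: lerXn2r; rewrite ?nnegrE ?mulr_ge0 ?rnorm_ge0//; lra.
apply: le_trans (ler_wpM2l r0 (rnormD _ _)) _.
rewrite rnormM rnormX exprS mulrDr.
have h1 := ler_wpM2l r0 zm.
have h2 : rnorm z * (r * rnorm (dpow z m)) <= r * (2 * r) ^+ m.
  by apply: ler_pM; rewrite ?rnorm_ge0 ?mulr_ge0 ?rnorm_ge0.
by rewrite mulrCA; lra.
Qed.

Lemma pow_taylor_le (z h : R[i]) (r : R) m : rnorm z <= r -> rnorm h <= r ->
  r ^+ 2 * rnorm ((z + h) ^+ m - z ^+ m - h * dpow z m) <=
  (4 * r) ^+ m * rnorm h ^+ 2.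
Proof.
move=> zr hr; have r0 := le_trans (rnorm_ge0 z) zr.
elim: m => [|m IH] /=.
  by rewrite !expr0 mulr0 subrr subr0 rnorm0 mulr0 mul1r exprn_ge0// rnorm_ge0.
(* The Taylor remainder of degree [m + 1] is [z + h] times that of degree [m], plus [h ^ 2] times
   the derivative. *)
rewrite (_ : _ - _ - _ = (z + h) * ((z + h) ^+ m - z ^+ m - h * dpow z m) +
    h ^+ 2 * dpow z m); last by rewrite !exprS; ring.
apply: le_trans (ler_wpM2l (sqr_ge0 r) (rnormD _ _)) _.
rewrite (rnormM (z + h)) (rnormM (h ^+ 2)) rnormX.
set a := rnorm (_ - _ - _) in IH *; set b := rnorm (dpow z m).
have b0 : r * b <= (4 * r) ^+ m.
  apply: le_trans (dpow_le m zr) _.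
  by apply: lerXn2r; rewrite ?nnegrE ?mulr_ge0//; lra.
have zh : rnorm (z + h) <= 2 * r by have := rnormD z h; lra.
have h1 : rnorm (z + h) * (r ^+ 2 * a) <= 2 * r * ((4 * r) ^+ m * rnorm h ^+ 2).
  by apply: ler_pM; rewrite ?rnorm_ge0 ?mulr_ge0 ?rnorm_ge0// sqr_ge0.
have h2 : r * rnorm h ^+ 2 * (r * b) <= r * rnorm h ^+ 2 * (4 * r) ^+ m.
  by apply: ler_wpM2l => //; rewrite mulr_ge0 ?sqr_ge0.
have h3 : 0 <= r * rnorm h ^+ 2 * (4 * r) ^+ m.
  apply: mulr_ge0; first by apply: mulr_ge0 => //; exact: sqr_ge0.
  by apply: exprn_ge0; exact: mulr_ge0.
rewrite [in leRHS]exprS; move: h1 h2 h3; rewrite !expr2.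
by move: ((4 * r) ^+ m) => c; lra.
Qed.

Lemma geometric_sum_le (K : R) n (v : 'I_n -> V) : 0 <= K ->
  (forall m, rnorm (v m) <= K / 2 ^+ m) -> rnorm (\sum_(m < n) v m) <= 2 * K.
Proof.
move=> K0 vK; apply: (@le_trans _ _ (2 * K - 2 * K / 2 ^+ n)); last first.
  by rewrite gerBl divr_ge0 ?mulr_ge0 ?exprn_ge0.
elim: n v vK => [|n IH] v vK.
  by rewrite big_ord0 rnorm0 expr0 divr1 subrr.
rewrite big_ord_recr; apply: le_trans (rnormD _ _) _.
have := vK ord_max; have := IH (fun m => v (widen_ord (leqnSn n) m)) (fun m => vK _).
by rewrite exprS invfM /=; move: ((2 ^+ n)^-1) => t; lra.
Qed.

Lemma power_series (u : nat -> V) (M K : R) : fast_complete V -> 0 < K ->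
  (forall n, rnorm (u n) <= M * K ^+ n) ->
  exists f : R[i] -> V,
    (forall z, rnorm z <= (4 * K)^-1 -> fast_cvg (power_sum u z) (f z)) /\
    (forall z, rnorm z <= (8 * K)^-1 -> qdiff f z).
Proof.
move=> cV K0 uM.
have M0 : 0 <= M.
  by have := uM 0%N; rewrite expr0 mulr1; apply: le_trans; exact: rnorm_ge0.
(* As [4 * r * K = 1 / 2], scalars bounded by a multiple of [(4 * r) ^+ m] give a geometric series;
   this serves for powers, derivatives and Taylor remainders. For [z] and [h] of size at most [r],
   [z + h] stays in the disc of radius [2 * r] where the sum is defined. *)
pose r := (8 * K)^-1.
have r0 : 0 < r by rewrite invr_gt0 mulr_gt0.
have r4 : (4 * K)^-1 = 2 * r by rewrite /r; field; rewrite gt_eqF.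
have rK : 4 * r * K = 2^-1 by rewrite /r; field; rewrite gt_eqF.
have scale_le (a : R[i]) (c t : R) m : 0 <= t -> t * rnorm a <= (4 * r) ^+ m * c ->
    t * rnorm (a *: u m) <= c * M / 2 ^+ m.
  move=> t0 ac; rewrite rnormZ mulrA.
  apply: (@le_trans _ _ ((4 * r) ^+ m * c * (M * K ^+ m))).
    by apply: ler_pM => //; rewrite ?mulr_ge0 ?rnorm_ge0.
  rewrite -exprVn -rK (exprMn _ (4 * r)).
  by move: ((4 * r) ^+ m) (K ^+ m) => x y; lra.
have cvg_series (a : nat -> R[i]) (c t : R) : 0 < t ->
    (forall m, t * rnorm (a m) <= (4 * r) ^+ m * c) ->
    exists l, fast_cvg (fun n => \sum_(m < n) a m *: u m) l.
  move=> t0 ac; apply: (cV _ (c * M / t)) => n.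
  rewrite big_ord_recr/= addrAC subrr add0r.
  rewrite -(ler_pM2l t0); apply: le_trans (scale_le _ c _ _ (ltW t0) (ac n)) _.
  by rewrite le_eqVlt; apply/orP; left; apply/eqP; field; rewrite gt_eqF//= gt_eqF.
have fE z : exists l, rnorm z <= 2 * r -> fast_cvg (power_sum u z) l.
  have [zr|_] := boolP (rnorm z <= 2 * r); last by exists 0.
  have [m|l lP] := @cvg_series (fun m => z ^+ m) 1 1 ltr01; last by exists l.
  rewrite mul1r mulr1 rnormX; apply: lerXn2r; rewrite ?nnegrE ?rnorm_ge0//; lra.
have {fE} /choice[f fP] := fE.
exists f; rewrite r4; split=> // z zr.
have zr2 : rnorm z <= 2 * r by lra.
have [m|d dP] := @cvg_series (dpow z) 1 r r0.
  rewrite mulr1; apply: le_trans (dpow_le m zr) _.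
  by apply: lerXn2r; rewrite ?nnegrE ?mulr_ge0 ?ltW//; lra.
exists d, (2 * M / r ^+ 2), r; split=> // h hr.
have zhr : rnorm (z + h) <= 2 * r by have := rnormD z h; lra.
have cv := fast_cvgB (fast_cvgB (fP _ zhr) (fP _ zr2)) (fast_cvgZ h dP).
apply: (fast_cvg_rnorm_le cv) => n.
rewrite /power_sum -sumrB scaler_sumr -sumrB.
rewrite (eq_bigr (fun m : 'I_n =>
  ((z + h) ^+ m - z ^+ m - h * dpow z m) *: u m)); last first.
  by move=> m _; rewrite !scalerBl scalerA.
have r20 : 0 < r ^+ 2 by rewrite exprn_gt0.
rewrite (_ : 2 * M / r ^+ 2 * rnorm h ^+ 2 = 2 * (rnorm h ^+ 2 * M / r ^+ 2)).
  apply: geometric_sum_le => [|m].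
    by apply: divr_ge0; [apply: mulr_ge0 => //|]; exact: sqr_ge0.
  rewrite -(ler_pM2l r20).
  apply: le_trans (scale_le _ _ _ _ (ltW r20) (pow_taylor_le m zr hr)) _.
  rewrite le_eqVlt; apply/orP; left; apply/eqP; field.
  by rewrite !gt_eqF.
by ring.
Qed.

End PowerSeries.

(** * SVEP and the index *)

Section AnalyticKernel.
Context {R : realType}.
Local Notation C := R[i].

Definition mx_qdiff m n (A : C -> 'M[C]_(m, n)) z :=
  forall i j, qdiff (fun w => (A w i j : C^o)) z.

Lemma mx_qdiff_cst m n (A : 'M[C]_(m, n)) z : mx_qdiff (fun=> A) z.
Proof. by move=> i j; exact: (@qdiff_cst _ C^o). Qed.

Lemma mx_qdiffM m n p (A : C -> 'M[C]_(m, n)) (B : C -> 'M[C]_(n, p)) z :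
  mx_qdiff A z -> mx_qdiff B z -> mx_qdiff (fun w => A w *m B w) z.
Proof.
move=> dA dB i j; under eq_fun do rewrite mxE.
by apply: (@qdiff_sum _ C^o) => k; apply: (@qdiffZ _ C^o).
Qed.

(* Where the rank of [G] is maximal, equal to [r], choose constant [P] and [Q]
   such that [P *m G *m Q] is an invertible r x r matrix; elsewhere Cramer's
   rule keeps the kernel vector analytic. *)
Lemma analytic_left_kernel (S : set C) n (G : C -> 'M[C]_(n.+1, n)) :
  S !=set0 -> (forall z, S z -> mx_qdiff G z) ->
  exists a : C -> 'rV[C]_n.+1,
    [/\ forall z, S z -> mx_qdiff a z, forall z, S z -> a z *m G z = 0
      & exists2 mu, S mu & a mu != 0].
Proof.
move=> [z0 Sz0] dG.
pose rk k := `[< exists2 z, S z & \rank (G z) = k >].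
have rk0 : exists k, rk k by exists (\rank (G z0)); apply/asboolP; exists z0.
have rkn k : rk k -> (k <= n)%N by case/asboolP => z _ <-; exact: rank_leq_col.
case: (ex_maxnP rk0 rkn) => r /asboolP[mu Smu rmu] rmax.
have [P [Q PGQ]] : exists (P : 'M[C]_(r, n.+1)) (Q : 'M[C]_(n, r)),
    P *m G mu *m Q = 1%:M.
  case: _ / rmu {rmax}.
  (* [G mu] is the product of [col_base], which has a left inverse, and [row_base], which has a
     right inverse. *)
  exists (pinvmx (col_base (G mu))), (pinvmx (row_base (G mu))).
  transitivity (pinvmx (col_base (G mu)) *m
    (col_base (G mu) *m row_base (G mu)) *m pinvmx (row_base (G mu))).
    by rewrite mulmx_base.
  rewrite (mulmxA (pinvmx _)) mulVpmx ?col_base_full// mul1mx.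
  by rewrite mulmxVp// row_base_free.
have [u u0 uG] := left_kernel_vector (G mu) (ltnSn n).
(* The second term of [b] is chosen so that [b z *m G z *m Q = 0], by [\adj D *m D = \det D]. The
   extra factor [\det (D z)] below disposes of the points where [D z] is singular. *)
pose D z := P *m G z *m Q.
pose b z := \det (D z) *: u - u *m G z *m Q *m \adj (D z) *m P.
exists (fun z => \det (D z) *: b z).
have dD z : S z -> mx_qdiff D z.
  move=> Sz; apply: mx_qdiffM; last exact: mx_qdiff_cst.
  by apply: mx_qdiffM; [exact: mx_qdiff_cst|exact: dG].
have ddet z : S z -> qdiff (fun w => (\det (D w) : C^o)) z.
  by move=> Sz; apply: qdiff_det; exact: dD.
split=> [z Sz i j|z Sz|].
- under eq_fun do rewrite mxE.
  apply: (@qdiffZ _ C^o); first exact: ddet.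
  under eq_fun do rewrite mxE [X in _ + X]mxE -mulN1r.
  apply: (@qdiffD _ C^o).
    under eq_fun do rewrite mxE.
    by apply: (@qdiffZ _ C^o); [exact: ddet|exact: (@qdiff_cst _ C^o)].
  apply: (@qdiffZ _ C^o); first exact: (@qdiff_cst _ C^o).
  apply: mx_qdiffM; last exact: mx_qdiff_cst.
  apply: mx_qdiffM; last by move=> k l; apply: qdiff_adj; exact: dD.
  apply: mx_qdiffM; last exact: mx_qdiff_cst.
  by apply: mx_qdiffM; [exact: mx_qdiff_cst|exact: dG].
- have [->|D0] := eqVneq (\det (D z)) 0; first by rewrite scale0r mul0mx.
  rewrite -scalemxAl; suff -> : b z *m G z = 0 by rewrite scaler0.
  have uD : D z \in unitmx by rewrite unitmxE unitfE.
  (* Here [P *m G z] has rank at least [r], the maximal rank of [G], so it has the row space of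
     [G z]. Then [b z *m G z = w *m P *m G z], and multiplying by [Q] shows [w = 0]. *)
  have GP : (G z <= P *m G z)%MS.
    have rle : (\rank (G z) <= r)%N by apply: rmax; apply/asboolP; exists z.
    have rge : (r <= \rank (P *m G z))%N.
      by rewrite -[X in (X <= _)%N](mxrank_unit uD) mxrankM_maxl.
    rewrite -(geq_leqif (mxrank_leqif_sup (submxMl P (G z)))).
    exact: leq_trans rle rge.
  have /submxP[w bG] := submx_trans (submxMl (b z) (G z)) GP.
  have : w *m D z = 0.
    rewrite /D !mulmxA -(mulmxA w) -bG /b !mulmxBl -!scalemxAl.
    rewrite -!(mulmxA _ P) -!(mulmxA _ (P *m _)) -/(D z).
    rewrite -(mulmxA _ (\adj _)) mul_adj_mx mul_mx_scalar.
    by rewrite scalemxAl subrr.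
  move/(congr1 (mulmx^~ (invmx (D z)))); rewrite mulmxK// mul0mx => w0.
  by rewrite bG w0 mul0mx.
- exists mu => //; rewrite /b /D PGQ det1 !scale1r uG !mul0mx subr0 //.
Qed.

End AnalyticKernel.

(** * SVEP at a point bounds the nullity by the codimension of the range *)

Section SvepIndex.
Context {R : realType}.

Lemma fast_cvgZl (Y : normedModType R[i]) (c : nat -> R[i]^o) (l : R[i]^o)
    (e : Y) : fast_cvg c l ->
  fast_cvg (fun n => (c n : R[i]) *: e) ((l : R[i]) *: e).
Proof.
move=> [K cK]; exists (K * rnorm e) => n.
by rewrite -scalerBl rnormZ mulrAC ler_wpM2r ?rnorm_ge0.
Qed.

Lemma fast_cvg_sum (Y : normedModType R[i]) n
    (u : 'I_n -> nat -> Y) (l : 'I_n -> Y) :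
  (forall i, fast_cvg (u i) (l i)) ->
  fast_cvg (fun k => \sum_(i < n) u i k) (\sum_(i < n) l i).
Proof.
elim: n u l => [|n IH] u l ul.
  by rewrite big_ord0; under eq_fun do rewrite big_ord0; exact: fast_cvg_cst.
rewrite big_ord_recr; under eq_fun do rewrite big_ord_recr.
by apply: fast_cvgD => [|//]; apply: IH => i; exact: ul.
Qed.

Lemma shift_opE (Y : normedModType R[i]) (T : bounded_op Y Y) (l : R[i]) y :
  shift_op T l y = T y - l *: y.
Proof. by []. Qed.

Section Eigenvectors.
Context {Y : normedModType R[i]} (S : bounded_op Y Y) (n : nat).
Hypotheses (cY : fast_complete Y).
Variables (e : 'I_n -> Y) (kappa : 'I_n -> dual Y) (K : R).
Hypotheses (K0 : 0 <= K)
  (kP : forall y, exists2 x, y = S x + \sum_(i < n) (kappa i y : R[i]) *: e i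
                           & rnorm x <= K * rnorm y).

(* Iterating a bounded section of [S] from a kernel vector [k] gives a power
   series solving [(S - z) x(z) = 0] up to the complement of the range. *)
Lemma approximate_eigenvectors (k : Y) : S k = 0 ->
  exists x : R[i] -> Y,
    [/\ x 0 = k,
      forall z, rnorm z <= (8 * (K + 1))^-1 -> qdiff x z
    & forall z, rnorm z <= (8 * (K + 1))^-1 -> S (x z) =
        z *: (x z - \sum_(i < n) (kappa i (x z) : R[i]) *: e i)].
Proof.
move=> Sk.
have /choice[s sP] y : exists x, y = S x + \sum_(i < n) (kappa i y : R[i]) *: e i /\
    rnorm x <= K * rnorm y by have [x] := kP y; exists x.
have Ss y : S (s y) = y - \sum_(i < n) (kappa i y : R[i]) *: e i.
  by rewrite {2}(sP y).1 addrK.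
pose u m := iter m s k.
(* [K] may be zero, whereas the power series needs a positive growth rate. *)
have K1 : 0 < K + 1 by rewrite ltr_wpDl.
have uM m : rnorm (u m) <= rnorm k * (K + 1) ^+ m.
  elim: m => [|m IH]; first by rewrite expr0 mulr1.
  apply: le_trans (sP _).2 _; rewrite exprS mulrCA.
  by apply: ler_pM => //; [exact: rnorm_ge0|rewrite lerDl].
have [x [xP dx]] := power_series cY K1 uM.
have r4 z : rnorm z <= (8 * (K + 1))^-1 -> rnorm z <= (4 * (K + 1))^-1.
  move/le_trans; apply; rewrite lef_pV2 ?posrE ?mulr_gt0//.
  by rewrite ler_pM2r// ler_nat.
exists x; split=> // [|z /r4 zr].
  have /xP/fast_cvgS : rnorm (0 : R[i]) <= (4 * (K + 1))^-1.
    by rewrite rnorm0 invr_ge0 mulr_ge0// ltW.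
  move/fast_cvg_uniq; apply.
  have -> : (fun m => power_sum u 0 m.+1) = fun=> k.
    apply: funext => m; rewrite /power_sum big_ord_recl expr0 scale1r big1 ?addr0//.
    by move=> i _; rewrite expr0n /= scale0r.
  exact: fast_cvg_cst.
(* [N] projects onto the range of [S]. Since [S] kills [u 0] and sends [u m.+1] to [N (u m)], it
   maps each partial sum to [z *: N] of the previous one; the equation follows in the limit. *)
pose N y := y - \sum_(i < n) (kappa i y : R[i]) *: e i.
have NP : fast_cvg (fun m => z *: N (power_sum u z m)) (z *: N (x z)).
  apply/fast_cvgZ/fast_cvgB; first exact: xP.
  by apply: fast_cvg_sum => i; apply/fast_cvgZl/fast_cvg_op/xP.
apply: fast_cvg_uniq NP; have := fast_cvgS (fast_cvg_op S (xP _ zr)).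
rewrite (_ : (fun m => _) = fun m => z *: N (power_sum u z m))//.
apply: funext => m; rewrite /power_sum big_ord_recl bounded_opD bounded_opZ.
have -> : S (u (@ord0 m)) = 0 := Sk.
rewrite scaler0 add0r /N bounded_op_sum scalerBr scaler_sumr.
have -> : \sum_(i < n) (kappa i (\sum_(j < m) z ^+ j *: u j) : R[i]) *: e i =
    \sum_(j < m) z ^+ j *: \sum_(i < n) (kappa i (u j) : R[i]) *: e i.
  under eq_bigr do rewrite bounded_op_sum scaler_suml.
  rewrite exchange_big; apply: eq_bigr => j _.
  by rewrite scaler_sumr; apply: eq_bigr => i _; rewrite scalerA.
rewrite scaler_sumr -sumrB; apply: eq_bigr => j _.
by rewrite lift0 /u iterS Ss scalerBr exprS !scalerA.
Qed.

End Eigenvectors.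

(** The defect of [x j z] as an eigenvector of [S] is governed by its [n] coordinates [kappa i]. For
    [n + 1] series, an analytic left kernel vector of the coordinate matrix [G] cancels all defects;
    SVEP makes the resulting solution zero, against the independence of the [x j z]. *)
Theorem svep_alpha_le_beta (Y : normedModType R[i]) (T : bounded_op Y Y)
    (l : R[i]) (n m : nat) (f : 'I_m -> Y) :
  fast_complete Y -> svep_at T l ->
  quotient_dim setT (range (shift_op T l)) n ->
  (forall i, ker_op (shift_op T l) (f i)) -> free_mod [set 0] f -> (m <= n)%N.
Proof.
move=> cY svepT /cofinite_range_coordinates[//|//|e [kappa [K [K0 kT _ kP]]]] kerf ff.
rewrite leqNgt; apply/negP => nm.
pose k (i : 'I_n.+1) := f (widen_ord nm i).
have fk : free_mod [set 0] k.
  move=> c /= c0.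
  (* Coefficients of the first [n + 1] vectors are extended by zero to all [m]. *)
  pose d (i : 'I_m) := if insub (val i) is Some j then c j else 0.
  have dw j : d (widen_ord nm j) = c j by rewrite /d /= valK.
  have d0 : \sum_(i < m) d i *: f i = 0.
    rewrite (bigID (fun i : 'I_m => (i < n.+1)%N)) /= [X in _ + X]big1 ?addr0.
      rewrite (big_ord_narrow nm) -[RHS]c0; apply: eq_bigr => j _.
      by rewrite dw.
    by move=> i ni; rewrite /d insubF ?scale0r//; exact/negbTE.
  by move=> i; rewrite -dw; exact: ff.
set S := shift_op T l in kerf kT kP.
have /choice[x xP] (j : 'I_n.+1) :=
  approximate_eigenvectors cY K0 kP (kerf (widen_ord nm j)).
have [psi psiP] := dual_basis fk.
(* [W 0] is the identity because [psi] is dual to the initial vectors; a nonzero determinant nearby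
   keeps the [x j z] independent. *)
pose W z : 'M[R[i]]_n.+1 := \matrix_(i, j) psi i (x j z).
have r0 : 0 < (8 * (K + 1))^-1 by rewrite invr_gt0 mulr_gt0// ltr_wpDl.
have [eps eps0 We] : exists2 eps : R, 0 < eps &
    forall h, rnorm h < eps -> (\det (W (0 + h)) : R[i]^o) != 0.
  apply: (@qdiff_neq0 _ R[i]^o (fun z => \det (W z))).
    apply: qdiff_det => i j; under eq_fun do rewrite mxE.
    by apply: qdiff_op; have [_ + _] := xP j; apply; rewrite rnorm0 ltW.
  rewrite (_ : W 0 = 1%:M) ?det1 ?oner_neq0//.
  by apply/matrixP => i j; rewrite !mxE; have [-> _ _] := xP j; rewrite psiP.
pose delta := Num.min eps (8 * (K + 1))^-1.
have delta0 : 0 < delta by rewrite lt_min eps0.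
have xr j z : rnorm z < delta -> qdiff (x j) z.
  rewrite lt_min => /andP[_ /ltW zr]; have [_ + _] := xP j; exact.
have xE j z : rnorm z < delta ->
    S (x j z) = z *: (x j z - \sum_(i < n) (kappa i (x j z) : R[i]) *: e i).
  rewrite lt_min => /andP[_ /ltW zr]; have [_ _ +] := xP j; exact.
pose G z : 'M[R[i]]_(n.+1, n) := \matrix_(j, i) kappa i (x j z).
have [||a [da aG [mu mu_delta amu]]] :=
    @analytic_left_kernel R [set z | rnorm z < delta] n G.
- by exists 0; rewrite /= rnorm0.
- move=> z zd i j; under eq_fun do rewrite mxE.
  by apply: qdiff_op; exact: xr.
pose F z := \sum_(j < n.+1) a z 0 j *: x j z.
have SF z : rnorm z < delta -> S (F z) = z *: F z.
  move=> zd; rewrite bounded_op_sum.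
  under eq_bigr do rewrite xE// scalerA mulrC -scalerA scalerBr.
  rewrite -scaler_sumr sumrB; congr (_ *: _).
  rewrite [X in _ - X](_ : _ = 0) ?subr0//.
  under eq_bigr do rewrite scaler_sumr.
  rewrite exchange_big big1// => i _.
  under eq_bigr do rewrite scalerA.
  rewrite -scaler_suml; have /rowP/(_ i) := aG z zd; rewrite !mxE.
  by under eq_bigr do rewrite mxE; move=> ->; rewrite scale0r.
have ballE z : ball (l : R[i]^o) delta%:C z -> rnorm (z - l) < delta.
  by rewrite -ball_normE /= -rnormE ltcR rdistC.
have Fmu : F mu = 0.
  have := svepT delta%:C _ (fun z => F (z - l)) _ _ (mu + l).
  rewrite addrK; apply=> [|z /ballE zd|z /ballE zd|]; first by rewrite ltcR.
  - apply: qdiff_derivable; apply: (@qdiff_shift _ _ F).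
    apply: qdiff_sum => j; apply: qdiffZ; last exact: xr.
    exact: da.
  - have := SF _ zd; rewrite /S !shift_opE => /eqP; rewrite scalerBl.
    by rewrite eq_sym subr_eq subrK => /eqP <-; rewrite subrr.
  - by rewrite -ball_normE /= -rnormE ltcR opprD addrCA subrr addr0 rnormN.
have aW : a mu *m (W mu)^T = 0.
  apply/rowP => i; rewrite !mxE.
  have := congr1 (psi i) Fmu; rewrite bounded_op0 bounded_op_sum => h.
  apply: etrans h.
  by apply: eq_bigr => j _; rewrite !mxE.
have uW : (W mu)^T \in unitmx.
  rewrite unitmx_tr unitmxE unitfE -[mu]add0r; apply: We.
  by move: mu_delta; rewrite /= lt_min => /andP[].
case/eqP: amu; move/(congr1 (mulmx^~ (invmx (W mu)^T))): aW.
by rewrite mulmxK// mul0mx.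
Qed.

End SvepIndex.

(** * Block triangular operators *)

Section BlockDimensions.
Context {R : realType} {X : normedModType R[i]} (A B C : bounded_op X X).
Let M := block_triangular A C B.

(** The kernel of the connecting map from the kernel of [B] to [X] modulo the range of [A], induced
    by [C]; also the second projection of the kernel of [M]. *)
Definition corner_kernel : set X := [set w | B w = 0 /\ range A (C w)].
(** This is the range of [A] plus the image under [C] of the kernel of [B]: modulo the range of [A],
    the image of the connecting map. *)
Definition corner_range : set X := [set y | range M (y, 0)].

Lemma block_triangularE z : M z = (A z.1 + C z.2, B z.2).
Proof. by []. Qed.

Lemma corner_kernel_subspace : lin_subspace corner_kernel.
Proof.
split=> [|a x y [Bx Ax] [By Ay]]; rewrite /corner_kernel /=.
  by rewrite !bounded_op0; split=> //; exact: (range_subspace A).1.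
rewrite !bounded_op_linear Bx By scaler0 addr0; split=> //.
exact: (range_subspace A).2.
Qed.

Lemma corner_range_subspace : lin_subspace corner_range.
Proof.
split=> [|a x y Mx My]; first exact: (range_subspace M).1.
rewrite /corner_range /= (_ : (a *: x + y, 0) = a *: (x, 0) + (y, 0)).
  exact: (range_subspace M).2.
by rewrite [RHS]surjective_pairing /= scaler0 addr0.
Qed.

(** The middle of the snake sequence: [d] is the rank of the connecting map, seen on its source and
    on its target. *)
Lemma ker_corner_range d :
  quotient_dim (ker_op B) corner_kernel d <->
  quotient_dim corner_range (range A) d.
Proof.
have lC := bounded_op_linear C.
have cU u : ker_op B u -> corner_range (C u).
  move=> Bu; exists (0, u) => //.
  by rewrite block_triangularE /= bounded_op0 add0r Bu.
have cW u : ker_op B u -> range A (C u) <-> corner_kernel u.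
  by move=> Bu; split=> [|[]].
have cO v : corner_range v -> exists2 u, ker_op B u & range A (v - C u).
  move=> [[x w] _ [<- Bw]]; exists w => //; exists x => //.
  by rewrite addrK.
have [sB sA] := (ker_subspace B, range_subspace A).
by split; [exact: (quotient_dim_image lC sB sA)
          |exact: (quotient_dim_preimage lC sB sA)].
Qed.

(** The kernel of [A], embedded in the first summand, is the part of the kernel of [M] killed by the
    second projection. *)
Lemma ker_block_dim a : quotient_dim (ker_op M) [set 0] a ->
  exists p k, [/\ quotient_dim (ker_op A) [set 0] p,
    quotient_dim corner_kernel [set 0] k & a = (p + k)%N].
Proof.
pose kA : set (X * X) := [set z | z.2 = 0 /\ A z.1 = 0].
move=> /(@quotient_dim_sub _ _ _ kA)[||||k [p [Mk kp ->]]].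
- exact: subspace0.
- by move=> _ -> /=; split=> //; exact: bounded_op0.
- by move=> [x w] [/= -> Ax]; rewrite /ker_op /= Ax !bounded_op0 addr0.
- split=> [|a' [x w] [x' w'] [/= -> Ax] [/= -> Ax']].
    by split=> //; exact: bounded_op0.
  by split=> /=; rewrite ?scaler0 ?addr0// bounded_op_linear Ax Ax' scaler0 addr0.
exists p, k; rewrite addnC; split=> //.
- have lin : linear (fun x : X => (x, 0 : X)).
    by move=> a' x y /=; congr (_, _); rewrite /= scaler0 addr0.
  apply: (quotient_dim_preimage lin (ker_subspace A) (@subspace0 _ _)) kp.
  + by [].
  + by move=> u _; split=> [[]|->].
  + by move=> [x w] [/= -> Ax]; exists x => //=; rewrite subrr.
- have lin : linear (@snd X X) by [].
  apply: (quotient_dim_image lin (ker_subspace M) (@subspace0 _ _)) Mk.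
  + move=> [x w] [AC Bw]; split=> //=; exists (- x) => //.
    by rewrite bounded_opN; exact: addr0_eq AC.
  + move=> [x w] [AC Bw]; split=> [w0|[]//]; split=> //.
    by move: AC; rewrite /= in w0 *; rewrite w0 bounded_op0 addr0.
  + move=> w [Bw [x _ AC]]; exists (- x, w); last by rewrite /= subrr.
    by rewrite /ker_op /= Bw bounded_opN AC addNr.
Qed.

(** The intermediate space is [X] times the range of [B]; modulo the range of [M], each of its
    elements is represented in the first summand. *)
Lemma range_block_dim b : quotient_dim setT (range M) b ->
  exists r s, [/\ quotient_dim setT corner_range r,
    quotient_dim setT (range B) s & b = (r + s)%N].
Proof.
pose XB : set (X * X) := [set z | range B z.2].
move=> /(@quotient_dim_sub _ _ _ XB)[||//||s [r [TX XM ->]]].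
- exact: range_subspace.
- by move=> _ [[x w] _ <-]; exists w.
- split=> [|a' [x w] [x' w'] Bw Bw']; first exact: (range_subspace B).1.
  exact: (range_subspace B).2.
exists r, s; rewrite addnC; split=> //.
- have lin : linear (fun x : X => (x, 0 : X)).
    by move=> a' x y /=; congr (_, _); rewrite /= scaler0 addr0.
  apply: (quotient_dim_preimage lin (@subspaceT _ _) (range_subspace M)) XM.
  + by move=> y _; exact: (range_subspace B).1.
  + by [].
  + move=> [y v] [w _ /= <-]; exists (y - C w) => //; exists (0, w) => //.
    rewrite /= bounded_op0 add0r.
    by congr (_, _); rewrite /= ?subr0// opprB addrC subrK.
- have lin : linear (@snd X X) by [].
  apply: (quotient_dim_image lin (@subspaceT _ _) (range_subspace B)) TX => //.
  by move=> v _; exists (0, v) => //=; rewrite subrr; exact: (range_subspace B).1.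
Qed.

Let corner_kernel_ker : corner_kernel `<=` ker_op B.
Proof. by move=> w []. Qed.

Let range_corner_range : range A `<=` corner_range.
Proof.
by move=> _ [x _ <-]; exists (x, 0); rewrite //= !bounded_op0 addr0.
Qed.

Lemma range_dim_of_ker k r q :
  quotient_dim corner_kernel [set 0] k -> quotient_dim setT corner_range r ->
  quotient_dim (ker_op B) [set 0] q ->
  exists2 d, q = (d + k)%N & quotient_dim setT (range A) (r + d).
Proof.
move=> Kk Rr Bq; have sK := corner_kernel_subspace.
have K0 : [set 0] `<=` corner_kernel by move=> _ ->; exact: sK.1.
have [d [k' [Bd Kk' ->]]] :=
  quotient_dim_sub (@subspace0 _ _) K0 corner_kernel_ker sK Bq.
exists d; first by rewrite (quotient_dim_uniq (@subspace0 _ _) Kk Kk').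
apply: (quotient_dimD (range_subspace A) range_corner_range _ _ Rr) => //.
  exact: corner_range_subspace.
exact/ker_corner_range.
Qed.

Lemma ker_dim_of_range k r q :
  quotient_dim corner_kernel [set 0] k -> quotient_dim setT corner_range r ->
  quotient_dim setT (range A) q ->
  exists2 d, q = (r + d)%N & quotient_dim (ker_op B) [set 0] (d + k).
Proof.
move=> Kk Rr Aq; have sR := corner_range_subspace.
have sK := corner_kernel_subspace.
have K0 : [set 0] `<=` corner_kernel by move=> _ ->; exact: sK.1.
have RT : corner_range `<=` setT by [].
have [r' [d [Rr' Rd ->]]] :=
  quotient_dim_sub (range_subspace A) range_corner_range RT sR Aq.
exists d; first by rewrite (quotient_dim_uniq sR Rr Rr').
apply: (quotient_dimD (@subspace0 _ _) K0 corner_kernel_ker sK _ Kk).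
exact/ker_corner_range.
Qed.

End BlockDimensions.

(** * Adjoints *)

Section DualIndex.
Context {R : realType}.
Implicit Types X Y : normedModType R[i].

Lemma shift_adjoint X (T : bounded_op X X) (l : R[i]) :
  shift_op (adjoint T) l = adjoint (shift_op T l).
Proof.
apply: bounded_opP => g; apply: bounded_opP => x.
by rewrite shift_opE bounded_opBE bounded_opZE /= bounded_opB bounded_opZ.
Qed.

(* [factor] and [sep] are what closedness of the range of [S] provides. *)
Lemma svep_adjoint_beta_le X (T : bounded_op X X) (l : R[i]) p :
  let S := shift_op T l in
  svep_at (adjoint T) l ->
  (forall g : dual X, (forall x, S x = 0 -> g x = 0) -> range (adjoint S) g) ->
  (forall y, ~ range S y -> exists2 h : dual X, adjoint S h = 0 & h y <> 0) ->
  quotient_dim (ker_op S) [set 0] p ->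
  exists2 m, (m <= p)%N & quotient_dim setT (range S) m.
Proof.
move=> S svepT factor sep [e [_ _ se]].
(* By [factor], functionals that are free modulo the range of the adjoint stay independent on the
   kernel of [S], hence number at most [p]. *)
have [n np betaS] : exists2 n, (n <= p)%N &
    quotient_dim setT (range (adjoint S)) n.
  apply: quotient_dim_exists; first exact: range_subspace.
  move=> m g _ fg; rewrite leqNgt; apply/negP => pm.
  have [u u0 ue] := left_kernel_vector (\matrix_(j, i) (g j (e i) : R[i])) pm.
  case/eqP: u0; apply/rowP => j; rewrite mxE; move: j.
  apply: (fg (fun j => u 0 j)); apply: factor => x Sx.
  have [c /eqP] := se x Sx; rewrite subr_eq0 => /eqP ->.
  rewrite dual_sumE; under eq_bigr do rewrite bounded_op_sum mulr_sumr.
  rewrite exchange_big big1// => i _.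
  under eq_bigr do rewrite mulrCA.
  rewrite -mulr_sumr; have /rowP/(_ i) := ue; rewrite !mxE.
  by under eq_bigr do rewrite mxE; move=> ->; rewrite mulr0.
(* This is where SVEP of the adjoint enters, through the index inequality in the dual space. *)
have [m mn [h [hS _ sh]]] : exists2 m, (m <= n)%N &
    quotient_dim (ker_op (adjoint S)) [set 0] m.
  apply: quotient_dim_exists; first exact: subspace0.
  move=> m f kf ff; apply: svep_alpha_le_beta svepT _ _ ff.
  - exact: dual_fast_complete.
  - by rewrite shift_adjoint.
  - by rewrite shift_adjoint.
(* By [sep], a combination of the [y j] killed by the kernel of the adjoint is in the range of [S];
   so at most [m] vectors are free modulo that range. *)
have [b bm betaT] : exists2 b, (b <= m)%N & quotient_dim setT (range S) b.
  apply: quotient_dim_exists; first exact: range_subspace.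
  move=> b y _ fy; rewrite leqNgt; apply/negP => mb.
  have [u u0 uh] := left_kernel_vector (\matrix_(j, i) (h i (y j) : R[i])) mb.
  case/eqP: u0; apply/rowP => j; rewrite mxE; move: j.
  apply: (fy (fun j => u 0 j)); apply: contrapT => /sep[g Sg]; apply.
  have [c /eqP] := sh g Sg; rewrite subr_eq0 => /eqP ->.
  rewrite dual_sumE big1// => i _; rewrite bounded_op_sum.
  rewrite (_ : \sum_(j < b) _ = 0) ?mulr0//.
  by have /rowP/(_ i) := uh; rewrite !mxE; under eq_bigr do rewrite mxE.
by exists b => //; rewrite (leq_trans bm)// (leq_trans mn).
Qed.

(** * Factorization and separation for [A], deduced from the range of [M] *)

Section Corner.
Context {X : normedModType R[i]} (A B C : bounded_op X X).
Hypothesis cX : fast_complete X.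
Let M := block_triangular A C B.

Lemma corner_incl_bounded :
  (fun x : X => (x, 0) : X * X) \in @bounded_linear R X (X * X)%type.
Proof.
apply: (@bounded_linear_rnorm _ _ _ _ 1) => [a x y|x].
  by rewrite [RHS]surjective_pairing /= scaler0 addr0.
by apply: (le_trans (rnorm_pair_le _)); rewrite /= rnorm0 addr0 mul1r.
Qed.

Lemma fst_bounded : (@fst X X) \in @bounded_linear R (X * X)%type X.
Proof.
by apply: (@bounded_linear_rnorm _ _ _ _ 1) => // z; rewrite mul1r rnorm_fst.
Qed.

Lemma snd_bounded : (@snd X X) \in @bounded_linear R (X * X)%type X.
Proof.
by apply: (@bounded_linear_rnorm _ _ _ _ 1) => // z; rewrite mul1r rnorm_snd.
Qed.

Definition corner_incl := BoundedOp corner_incl_bounded.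
Definition fst_op := BoundedOp fst_bounded.
Definition snd_op := BoundedOp snd_bounded.

Variables (b k : nat).
Hypotheses (Mb : quotient_dim setT (range M) b)
  (Kk : quotient_dim (corner_kernel A B C) [set 0] k).

Let cXX : fast_complete (X * X)%type.
Proof. exact: (prod_fast_complete cX cX). Qed.

(** The functional [(g, psi)] vanishes on the kernel of [M], hence factors through [M]; restricting
    the factor to the first summand gives a preimage of [g]. *)
Lemma corner_factor (g psi : dual X) :
  (forall x w, A x + C w = 0 -> B w = 0 -> g x + psi w = 0) ->
  exists2 h : dual (X * X)%type, adjoint A (adjoint corner_incl h) = g &
    forall z, h (M z) = g z.1 + psi z.2.
Proof.
move=> gpsi.
have [|h _ hM] := cofinite_range_factor
    (g := adjoint fst_op g + adjoint snd_op psi) cXX cXX Mb.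
  by move=> [x w] [AC Bw]; exact: gpsi.
have hE z : h (M z) = g z.1 + psi z.2.
  by have := congr1 (fun f : dual _ => f z) hM.
exists h => //; apply: bounded_opP => x /=.
by have := hE (x, 0); rewrite /= !bounded_op0 !addr0.
Qed.

Lemma corner_range_factor (g : dual X) :
  (forall x, A x = 0 -> g x = 0) -> range (adjoint A) g.
Proof.
move=> gA; have [y [yK fy sy]] := Kk.
have [psi psiP] := dual_basis fy.
have /choice[v vP] i : exists x, A x = C (y i) by have [_ [x _ xC]] := yK i; exists x.
(* On [corner_kernel], [Psi w] is the value of [g] at a solution [x] of [A x = C w], independent of
   the solution as [g] kills the kernel of [A]. The dual basis extends it continuously to [X]. *)
pose Psi : dual X := \sum_(i < k) (g (v i) : R[i]) *: psi i.
have [|h hA _] := @corner_factor g Psi; last by exists (adjoint corner_incl h).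
move=> x w AC Bw.
have [|c /eqP] := sy w.
  split=> //; exists (- x) => //.
  by rewrite bounded_opN; exact: addr0_eq AC.
rewrite subr_eq0 => /eqP wE.
have Psiw : Psi w = g (\sum_(i < k) c i *: v i).
  rewrite dual_sumE bounded_op_sum; apply: eq_bigr => i _.
  rewrite wE bounded_op_sum (bigD1 i)//= psiP eqxx big1 ?addr0.
    by rewrite /GRing.scale /= mulr1 mulrC.
  by move=> j ji; rewrite psiP eq_sym (negPf ji) scaler0.
rewrite Psiw -bounded_opD; apply: gA.
rewrite bounded_opD -[RHS]AC wE !bounded_op_sum; congr (_ + _).
by apply: eq_bigr => i _; rewrite vP.
Qed.

(** If [(y, 0)] is outside the range of [M], a separating functional is restricted. Otherwise
    [(y, 0) = M (x, w)] with [w] outside [corner_kernel], and a functional that vanishes there but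
    not at [w] is factored through [M]. *)
Lemma corner_range_sep y : ~ range A y ->
  exists2 h : dual X, adjoint A h = 0 & h y <> 0.
Proof.
move=> Ay; have [|My] := pselect (range M (y, 0)); last first.
  have [H MH Hy] := cofinite_range_sep cXX cXX Mb My.
  exists (adjoint corner_incl H) => //; apply: bounded_opP => x /=.
  have := congr1 (fun f : dual _ => f (x, 0)) MH.
  by rewrite /= !bounded_op0 addr0.
move=> [[x w] _ [yE Bw]]; have [e [eK fe se]] := Kk.
have [psi psiP] := dual_basis fe.
have [|phi [phie phiw]] := @dual_avoids _ _ _ e psi w psiP.
  move=> c wE; have [_ [x' _ x'w]] : corner_kernel A B C w.
    rewrite wE; apply: subspace_sum => //; exact: corner_kernel_subspace.
  apply: Ay; exists (x + x') => //.
  by rewrite bounded_opD x'w.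
have [x' w' AC' Bw'|h hA hM] := @corner_factor 0 phi.
  have [|c /eqP] := se w'.
    split=> //; exists (- x') => //.
    by rewrite bounded_opN; exact: addr0_eq AC'.
  rewrite subr_eq0 => /eqP ->; rewrite bounded_op_sum big1 ?addr0//.
  by move=> i _; rewrite phie scaler0.
exists (adjoint corner_incl h) => //=.
have := hM (x, w); rewrite /= yE Bw phiw => ->.
by rewrite /= add0r; apply/eqP; exact: oner_neq0.
Qed.

End Corner.
End DualIndex.

(** * Weyl spectra *)

Section Weyl.
Context {R : realType}.

Lemma weyl_atI (X : normedModType R[i]) (T : bounded_op X X) (l : R[i]) n :
  fast_complete X ->
  quotient_dim (ker_op (shift_op T l)) [set 0] n ->
  quotient_dim setT (range (shift_op T l)) n -> weyl_at T l.
Proof.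
move=> cX kn rn; split; first split; [|by exists n|by exists n|].
  exact: (cofinite_range_closed cX cX rn).
rewrite /ind /alpha /beta (dim_quotientE (@subspace0 _ _) kn).
by rewrite (dim_quotientE (range_subspace _) rn) subrr.
Qed.

Lemma weyl_atE (X : normedModType R[i]) (T : bounded_op X X) (l : R[i]) :
  weyl_at T l -> exists n, quotient_dim (ker_op (shift_op T l)) [set 0] n /\
    quotient_dim setT (range (shift_op T l)) n.
Proof.
move=> [[_ [a ka] [b rb]]]; rewrite /ind /alpha /beta.
rewrite (dim_quotientE (@subspace0 _ _) ka) (dim_quotientE (range_subspace _) rb).
by move/eqP; rewrite subr_eq0 => /eqP[ab]; exists a; split; rewrite // ab.
Qed.

Lemma shift_block_triangular (X : normedModType R[i]) (A B C : bounded_op X X)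
    (l : R[i]) :
  shift_op (block_triangular A C B) l =
  block_triangular (shift_op A l) C (shift_op B l).
Proof.
apply: bounded_opP => z; rewrite !shift_opE /= [LHS]surjective_pairing /=.
by rewrite addrAC.
Qed.

Section Block.
Context {X : normedModType R[i]} (A B C : bounded_op X X) (l : R[i]).
Hypotheses (cX : fast_complete X) (weylM : weyl_at (block_triangular A C B) l).
Let A' := shift_op A l.
Let B' := shift_op B l.

(** For the shifted operators, [p + k] is the nullity of the block matrix and [r + s] the
    codimension of its range; the Weyl condition equates them. *)
Let block_dims : exists p k r s,
  [/\ quotient_dim setT (range (block_triangular A' C B')) (r + s),
    quotient_dim (ker_op A') [set 0] p /\ quotient_dim setT (range B') s,
    quotient_dim (corner_kernel A' B' C) [set 0] k,
    quotient_dim setT (corner_range A' B' C) r & (p + k = r + s)%N].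
Proof.
have [a] := weyl_atE weylM; rewrite shift_block_triangular => -[Ma Mb].
have [p [k [Ap Kk apk]]] := ker_block_dim Ma.
have [r [s [Rr Bs ars]]] := range_block_dim Mb.
by exists p, k, r, s; rewrite -ars -apk.
Qed.

Lemma svep_block_weyl : svep_at A l -> svep_at B l -> weyl_at A l /\ weyl_at B l.
Proof.
move=> svepA svepB; have [p [k [r [s [_ [Ap Bs] Kk Rr pkrs]]]]] := block_dims.
have [q qs Bq] : exists2 q, (q <= s)%N & quotient_dim (ker_op B') [set 0] q.
  apply: quotient_dim_exists; first exact: subspace0.
  by move=> m f; apply: svep_alpha_le_beta cX svepB Bs.
have [d qE Ard] := range_dim_of_ker Kk Rr Bq.
have pd : (p <= r + d)%N.
  case: (Ap) => e [ke fe _].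
  exact: (svep_alpha_le_beta cX svepA Ard ke fe).
(* From [q = d + k <= s] and [p + k = r + s] follows [p >= r + d], so both SVEP inequalities are
   equalities. *)
have [pE sE] : p = (r + d)%N /\ s = q by lia.
by split; [apply: (weyl_atI cX Ap); rewrite pE
          |apply: (weyl_atI cX Bq); rewrite -sE].
Qed.

Lemma svep_adjoint_block_weyl : svep_at (adjoint A) l -> svep_at (adjoint B) l ->
  weyl_at A l /\ weyl_at B l.
Proof.
move=> svepA svepB; have [p [k [r [s [Mb [Ap Bs] Kk Rr pkrs]]]]] := block_dims.
(* The codimension of the range of [A'] is not yet known to be finite, so the corner lemmas are
   needed; for [B'] it is [s] and the cofinite lemmas apply directly. *)
have [q qp Aq] := svep_adjoint_beta_le svepA
  (corner_range_factor cX Mb Kk) (corner_range_sep cX Mb Kk) Ap.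
have [d qE Bdk] := ker_dim_of_range Kk Rr Aq.
have [s' s'dk Bs'] := svep_adjoint_beta_le svepB
  (fun g => cofinite_range_factor (g := g) cX cX Bs)
  (fun y => cofinite_range_sep (y := y) cX cX Bs) Bdk.
have ss' := quotient_dim_uniq (range_subspace _) Bs Bs'.
(* Here [q = r + d <= p] and [s <= d + k], while [p + k = r + s]; again equality is forced
   throughout. *)
have [pE sE] : p = q /\ s = (d + k)%N by lia.
by split; [apply: (weyl_atI cX Ap); rewrite pE
          |apply: (weyl_atI cX Bdk); rewrite -sE].
Qed.

End Block.
End Weyl.

Theorem proposition2p4 (R : realType) (X : completeNormedModType R[i])
    (A B C : bounded_op X X) :
  (weyl_spectrum A `|` weyl_spectrum B `<=`
     weyl_spectrum (block_triangular A C B) `|` (no_svep A `|` no_svep B)) /\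
  (weyl_spectrum A `|` weyl_spectrum B `<=`
     weyl_spectrum (block_triangular A C B) `|`
       (no_svep (adjoint A) `|` no_svep (adjoint B))).
Proof.
have cX := @completeNormedMod_fast_complete R X.
split=> l AB; apply: contrapT => /not_orP[/contrapT weylM].
  move=> /not_orP[/contrapT svepA /contrapT svepB].
  have [wA wB] := svep_block_weyl cX weylM svepA svepB.
  by case: AB => [/(_ wA)|/(_ wB)].
move=> /not_orP[/contrapT svepA /contrapT svepB].
have [wA wB] := svep_adjoint_block_weyl cX weylM svepA svepB.
by case: AB => [/(_ wA)|/(_ wB)].
Qed.
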